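(* Let $H$ be a quadratic numerical semigroup minimally generated by $a_1<\dots<a_n$ such that $\operatorname{gr}_{\mathfrak m}K[H]$ is Cohen–Macaulay. Then: (a) either $n\leq e(H)\leq 2^{n-1}-2^{n-3}$, or $e(H)=2^{n-1}$; (b) if $e(H)=2^{n-1}-2^{n-3}$, then $I_H^*$ is an almost complete intersection ideal. Moreover, in the situation of (b), $I_H^*$ has a Gröbner basis consisting of quadrics with respect to the degree reverse lexicographic order induced by $x_n>\dots>x_1$.
   Context: A numerical semigroup is a submonoid $H\subseteq\mathbb{N}$ with $\mathbb{N}\setminus H$ finite; $G(H)$ is its minimal generating set and $e(H)=\min G(H)$. $K$ is a field, $K[H]=\bigoplus_{h\in H}Kt^h\subseteq K[t]$ with maximal ideal $\mathfrak m=(t^h:h\in H\setminus\{0\})$. With $G(H)=\{a_1<\dots<a_n\}$, $S=K[x_1,\dots,x_n]$ and $I_H=\ker(S\to K[H],\ x_i\mapsto t^{a_i})$. For $0\ne f\in S$, $f^*$ is its homogeneous component of least degree; $I^*=(f^*:0\neq f\in I)$. Then $\operatorname{gr}_{\mathfrak m}K[H]\cong S/I_H^*$. $H$ is quadratic if $I_H^*$ is generated by homogeneous polynomials of degree 2. An ideal $I$ is an almost complete intersection ideal if its minimal number of generators equals $\operatorname{height} I+1$. *)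

(* Defs.v *)
From HB Require Import structures.
From mathcomp Require Import all_boot all_order all_algebra.
From mathcomp Require Import mpoly.
Set Implicit Arguments.
Unset Strict Implicit.
Unset Printing Implicit Defensive.
Import GRing.Theory.
Local Open Scope ring_scope.

Definition num_semigroup (H : pred nat) : Prop :=
  H 0%N /\ (forall x y, H x -> H y -> H (x + y)%N) /\
  exists N : nat, forall x, (N <= x)%N -> H x.

Definition min_gen (H : pred nat) (x : nat) : Prop :=
  H x /\ (0 < x)%N /\
  ~ (exists y z, H y /\ H z /\ (0 < y)%N /\ (0 < z)%N /\ x = (y + z)%N).

Definition is_emb_mult (H : pred nat) (e : nat) : Prop :=
  min_gen H e /\ forall x, min_gen H x -> (e <= x)%N.

Section PolyDefs.
Variables (K : fieldType) (n : nat).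
Local Notation S := {mpoly K[n]}.

Definition is_ideal (I : S -> Prop) : Prop :=
  I 0 /\ (forall f g, I f -> I g -> I (f + g)) /\ (forall r f, I f -> I (r * f)).

Definition gen_ideal (P : S -> Prop) : S -> Prop :=
  fun f => exists (s : seq (S * S)),
    (forall q, q \in s -> P q.2) /\ f = \sum_(q <- s) q.1 * q.2.

Definition ideal_eq (I J : S -> Prop) : Prop := forall f, I f <-> J f.

Definition is_prime (P : S -> Prop) : Prop :=
  is_ideal P /\ ~ P 1 /\ (forall f g, P (f * g) -> P f \/ P g).

Definition strict_sub (I J : S -> Prop) : Prop :=
  (forall f, I f -> J f) /\ exists f, J f /\ ~ I f.

Definition prime_chain (c : nat -> S -> Prop) (d : nat) : Prop :=
  (forall i, (i <= d)%N -> is_prime (c i)) /\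
  (forall i, (i < d)%N -> strict_sub (c i) (c i.+1)).

Definition height_ge (I : S -> Prop) (h : nat) : Prop :=
  forall P, is_prime P -> (forall f, I f -> P f) ->
    exists c, prime_chain c h /\ ideal_eq (c h) P.
Definition height_eq (I : S -> Prop) (h : nat) : Prop :=
  height_ge I h /\ ~ height_ge I h.+1.

Definition generated_by (I : S -> Prop) (s : seq S) : Prop :=
  ideal_eq (gen_ideal (fun g => g \in s)) I.
Definition mingens_eq (I : S -> Prop) (m : nat) : Prop :=
  (exists s, size s = m /\ generated_by I s) /\
  (forall s, generated_by I s -> (m <= size s)%N).

Definition almost_complete_intersection (I : S -> Prop) : Prop :=
  exists h, height_eq I h /\ mingens_eq I h.+1.

Definition irrelevant (f : S) : Prop := f@_0%MM = 0.

Definition ideal_plus_seq (I : S -> Prop) (s : seq S) : S -> Prop :=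
  gen_ideal (fun g => I g \/ g \in s).

Definition regular_seq (I : S -> Prop) (s : seq S) : Prop :=
  (forall f, f \in s -> irrelevant f) /\
  ~ ideal_plus_seq I s 1 /\
  forall j, (j < size s)%N ->
    forall g, ideal_plus_seq I (take j s) (nth 0 s j * g) ->
              ideal_plus_seq I (take j s) g.

(* S/I is Cohen-Macaulay: depth (w.r.t. the homogeneous maximal ideal)
   equals Krull dimension, i.e. depth >= dim (depth <= dim always holds):
   for every chain of primes containing I of length d there is an
   S/I-regular sequence of length d in m. *)
Definition cohen_macaulay_quot (I : S -> Prop) : Prop :=
  forall c d, prime_chain c d -> (forall f, I f -> c 0%N f) ->
    exists s, size s = d /\ regular_seq I s.

Definition homogeneous (d : nat) (f : S) : Prop :=
  forall m, m \in msupp f -> mdeg m = d.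

(* least degree occurring in f (meaningful for f != 0) *)
Definition low_deg (f : S) : nat :=
  \big[minn/mdeg (head 0%MM (msupp f))]_(m <- msupp f) mdeg m.

Definition initial_form (f : S) : S :=
  \sum_(m <- msupp f | mdeg m == low_deg f) f@_m *: 'X_[m].

Definition toric_ideal (a : 'I_n -> nat) : S -> Prop :=
  fun f => mmap (@polyC K) (fun i => 'X^(a i)) f = 0.

Definition tangent_ideal (I : S -> Prop) : S -> Prop :=
  gen_ideal (fun g => exists f, I f /\ f != 0 /\ g = initial_form f).

(* Variable x_(i+1) is indexed by i : 'I_n.  m <_drl m' : smaller total
   degree, or same degree and at the first index i (i.e. the smallest
   variable x_1, then x_2, ...) where they differ, m has the larger exponent. *)
Definition drl_lt (m m' : 'X_{1..n}) : Prop :=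
  (mdeg m < mdeg m')%N \/
  (mdeg m = mdeg m' /\
   exists i : 'I_n, (forall j : 'I_n, (j < i)%N -> m j = m' j) /\ (m' i < m i)%N).

Definition lead_mon (f : S) (m : 'X_{1..n}) : Prop :=
  m \in msupp f /\ forall m', m' \in msupp f -> m' != m -> drl_lt m' m.

Definition mdivides (m m' : 'X_{1..n}) : Prop := forall i, (m i <= m' i)%N.

Definition groebner_basis (I : S -> Prop) (G : seq S) : Prop :=
  (forall g, g \in G -> I g) /\
  forall f, I f -> f != 0 ->
    exists g, g \in G /\ g != 0 /\
      exists mg mf, lead_mon g mg /\ lead_mon f mf /\ mdivides mg mf.

End PolyDefs.

(* Main.v *)
(* Let a = a_1 be the multiplicity.  A monomial is irreducible when, among the
   monomials of the same weight, it has the largest degree and then the smallest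
   position in the reverse lexicographic order; irreducible monomials represent
   the elements of H and are the standard monomials of I_H^*.
   Powers of all x_i with i > 1 lie in I_H^*, so a nonzerodivisor on the tangent
   cone forces x_1 to be one; hence multiplication by x_1 preserves
   irreducibility, and the irreducible monomials free of x_1 represent the
   residue classes mod a: there are exactly a of them.
   As I_H^* is generated by quadrics and contains a power of x_i (i > 1), some
   quadric involves x_i^2; a relation 2 a_i = a_k + a_l with k < i < l has
   leading monomial x_i^2, so all the irreducible monomials free of x_1 are
   squarefree.  If no x_i x_j is reducible, the leading monomials x_i^2 are
   pairwise coprime, so rewriting by the quadrics is confluent and all 2^(n-1)
   squarefree monomials are irreducible.  Otherwise some x_i x_j kills 2^(n-3)
   of them; in case of equality the n quadrics with leading monomials x_k^2 and
   x_i x_j form a minimal generating set and a Groebner basis, while the height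
   is n - 1 because a chain of primes in K[x_1, ..., x_n] has length
   at most n. *)
Require Import Defs.
From HB Require Import structures.
From mathcomp Require Import all_boot all_order all_algebra.
From mathcomp Require Import ssrcomplements mpoly zify.
From Stdlib Require Import Classical ClassicalEpsilon.
Set Implicit Arguments.
Unset Strict Implicit.
Unset Printing Implicit Defensive.
Import Order.TTheory GRing.Theory.
Local Open Scope ring_scope.

(** * Ideals, linear functionals on polynomials, primes generated by variables *)

Section Ideals.
Variables (K : fieldType) (n : nat).
Local Notation S := {mpoly K[n]}.
Implicit Types (I J P : S -> Prop) (f g r : S).

Lemma gen_ideal_is_ideal P : is_ideal (gen_ideal P).
Proof.
split; first by exists [::]; rewrite big_nil.
split=> [f g [s [Ps ->]] [t [Pt ->]]|r f [s [Ps ->]]].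
  exists (s ++ t); rewrite big_cat; split=> // q; rewrite mem_cat.
  by case/orP=> [/Ps|/Pt].
exists [seq (r * q.1, q.2) | q <- s]; split.
  by move=> q /mapP[q' /Ps Pq' ->].
by rewrite big_map mulr_sumr; apply: eq_bigr => q _; rewrite mulrA.
Qed.

Lemma gen_ideal_sub P g : P g -> gen_ideal P g.
Proof.
move=> Pg; exists [:: (1, g)]; rewrite big_seq1 mul1r; split=> // q.
by rewrite inE => /eqP->.
Qed.

Lemma ideal_sum I (T : eqType) (s : seq T) (Q : pred T) (F : T -> S) :
  is_ideal I -> (forall t, t \in s -> Q t -> I (F t)) ->
  I (\sum_(t <- s | Q t) F t).
Proof.
move=> [I0 [ID _]]; elim: s => [|t s IHs] IF; first by rewrite big_nil.
rewrite big_cons; have Is: I (\sum_(t <- s | Q t) F t).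
  by apply: IHs => u us; apply: IF; rewrite inE us orbT.
by case: ifP => // Qt; apply: ID => //; apply: IF; rewrite ?mem_head.
Qed.

Lemma ideal_scale I c f : is_ideal I -> I f -> I (c *: f).
Proof. by move=> [_ [_ IM]] If; rewrite -mul_mpolyC; apply: IM. Qed.

Lemma ideal_opp I f : is_ideal I -> I f -> I (- f).
Proof. by move=> II If; rewrite -scaleN1r; apply: ideal_scale. Qed.

Lemma gen_ideal_min I P :
  is_ideal I -> (forall g, P g -> I g) -> forall f, gen_ideal P f -> I f.
Proof.
move=> II PI f [s [Ps ->]]; apply: ideal_sum => // q /Ps /PI Iq _.
by case: II => _ [_]; apply.
Qed.

Lemma ideal_plus_seq_nil I f : is_ideal I -> ideal_plus_seq I [::] f <-> I f.
Proof.
move=> II; split; last by move=> If; apply: gen_ideal_sub; left.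
by apply: gen_ideal_min => // g [].
Qed.

Definition mlin (phi : 'X_{1..n} -> K) f := \sum_(m <- msupp f) f@_m * phi m.

Lemma mlinE phi k f : (msize f <= k)%N ->
  mlin phi f = \sum_(m : 'X_{1..n < k}) f@_m * phi m.
Proof.
move=> fk; rewrite /mlin (big_mksub 'X_{1..n < k}) ?msupp_uniq //=; last first.
  by move=> m /msize_mdeg_lt /leq_trans; apply.
by rewrite big_rmcond //= => m /memN_msupp_eq0->; rewrite mul0r.
Qed.

Lemma mlin_linear phi : linear_for *%R (mlin phi).
Proof.
move=> c f g; set k := maxn (msize f) (msize g).
have fk : (msize f <= k)%N by rewrite leq_maxl.
have gk : (msize g <= k)%N by rewrite leq_maxr.
have sk : (msize (c *: f + g) <= k)%N.
  rewrite (leq_trans (msizeD_le _ _)) // geq_max gk andbT.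
  by rewrite (leq_trans (msizeZ_le _ _)).
rewrite !(mlinE _ (k := k)) // mulr_sumr -big_split /=.
by apply: eq_bigr => m _; rewrite mcoeffD mcoeffZ mulrDl mulrA.
Qed.
HB.instance Definition _ phi :=
  GRing.isLinear.Build K S K *%R (mlin phi) (mlin_linear phi).

Lemma mlin0 phi : mlin phi 0 = 0.
Proof. exact: raddf0. Qed.

Lemma mlinX phi m : mlin phi 'X_[m] = phi m.
Proof. by rewrite /mlin msuppX big_seq1 mcoeffX eqxx mul1r. Qed.

Lemma mlinZ phi c f : mlin phi (c *: f) = c * mlin phi f.
Proof. by rewrite linearZ. Qed.

Lemma mlinXM phi w f :
  mlin phi ('X_[w] * f) = mlin (fun m => phi (m + w)%MM) f.
Proof.
rewrite mulrC /mlin (perm_big _ (msuppMX f w)) /= big_map.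
by apply: eq_bigr => m _; rewrite mcoeffMX addmC.
Qed.

(** By linearity only monomial multiples of generators need testing, and multiplication by ['X_[w]]
    shifts the argument of [phi]. *)
Lemma mlin_gen_ideal P phi f :
  (forall g w, P g -> mlin (fun m => phi (m + w)%MM) g = 0) ->
  gen_ideal P f -> mlin phi f = 0.
Proof.
move=> Pphi [s [Ps ->]]; rewrite linear_sum big_seq big1 // => q /Ps Pq.
rewrite [q.1]mpolyE mulr_suml linear_sum big1 // => w _.
by rewrite -scalerAl /= mlinZ mlinXM Pphi ?mulr0.
Qed.

Lemma mlin_indicator (Q : pred 'X_{1..n}) f :
  mlin (fun m => (Q m)%:R) f = \sum_(m <- msupp f | Q m) f@_m.
Proof.
rewrite /mlin [RHS]big_mkcond; apply: eq_bigr => m _.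
by case: (Q m); rewrite ?mulr1 ?mulr0.
Qed.

Lemma mlin_coeff u f : mlin (fun m => (m == u)%:R) f = f@_u.
Proof.
rewrite mlin_indicator; have [uf|uf] := boolP (u \in msupp f).
  by rewrite -big_filter filter_pred1_uniq ?msupp_uniq // big_seq1.
rewrite (memN_msupp_eq0 uf) big_seq_cond big1 // => m /andP[mf /eqP mu].
by rewrite -mu mf in uf.
Qed.

Lemma prime_kernel (R : idomainType) (F : {rmorphism S -> R}) :
  is_prime (fun f => F f = 0).
Proof.
split; first split; first by rewrite rmorph0.
  by split=> [f g|r f]; rewrite ?rmorphD ?rmorphM => ->; rewrite ?mulr0 // add0r.
split=> [/eqP|f g /eqP]; first by rewrite rmorph1 oner_eq0.
by rewrite rmorphM mulf_eq0 => /orP[]/eqP; [left | right].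
Qed.

Lemma msupp_mulP m f g : m \in msupp (f * g) ->
  exists m1 m2, [/\ m1 \in msupp f, m2 \in msupp g & m = (m1 + m2)%MM].
Proof. by move/msuppM_le/allpairsP=> [[m1 m2] [? ? ->]]; exists m1, m2. Qed.

(** Evaluation of the variables in [Z] at zero, written as a ring morphism into a domain so that its
    kernel is prime. *)
Definition kill (Z : pred 'I_n) : S -> S :=
  mmap (@mpolyC n K) (fun i => if Z i then 0 else 'X_i).

Definition avoids (Z : pred 'I_n) (m : 'X_{1..n}) :=
  [forall i, Z i ==> (m i == 0%N)].

Lemma killE Z f :
  kill Z f = \sum_(m <- msupp f | avoids Z m) f@_m *: 'X_[m].
Proof.
rewrite /kill /mmap [RHS]big_mkcond; apply: eq_bigr => m _.
rewrite mul_mpolyC; case: ifPn => [/forallP Zm|].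
  congr (_ *: _); rewrite mpolyXE_id; apply: eq_bigr => i _.
  by case: ifP => // Zi; move: (Zm i); rewrite Zi /= => /eqP->; rewrite !expr0.
rewrite negb_forall => /existsP[i]; rewrite negb_imply => /andP[Zi mi].
by rewrite /mmap1 (bigD1 i) //= Zi expr0n (negPf mi) mul0r scaler0.
Qed.

Lemma kill_coef Z f m : (kill Z f)@_m = if avoids Z m then f@_m else 0.
Proof.
rewrite killE linear_sum /=.
have [mf|mf] := boolP (m \in msupp f).
  rewrite big_mkcond (bigD1_seq m) ?msupp_uniq //= big1 ?addr0; last first.
    by move=> u um; case: ifP => // _; rewrite mcoeffZ mcoeffX (negPf um) mulr0.
  by case: ifP => // _; rewrite mcoeffZ mcoeffX eqxx mulr1.
rewrite (memN_msupp_eq0 mf) if_same big_seq_cond big1 // => u /andP[uf _].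
rewrite mcoeffZ mcoeffX; case: eqP => [um|_]; last by rewrite mulr0.
by rewrite -um uf in mf.
Qed.

(* The prime ideal generated by the variables in [Z]. *)
Definition varideal Z f := kill Z f = 0.

Lemma varidealP Z f : varideal Z f <-> forall m, avoids Z m -> f@_m = 0.
Proof.
split=> [fZ m Zm|fZ]; first by move: (kill_coef Z f m); rewrite Zm fZ mcoeff0.
by apply/mpolyP=> m; rewrite kill_coef mcoeff0; case: ifP => // /fZ.
Qed.

Lemma varideal_prime Z : is_prime (varideal Z).
Proof. exact: prime_kernel. Qed.

Lemma varidealX Z i : varideal Z 'X_i <-> Z i.
Proof.
rewrite /varideal /kill mmapX mmap1U; case: ifP => // _; split=> // /eqP.
by rewrite -msize_poly_eq0 msizeX.
Qed.

Lemma varideal_mono (Z Z' : pred 'I_n) f :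
  {subset Z <= Z'} -> varideal Z f -> varideal Z' f.
Proof.
move=> ZZ' /varidealP fZ; apply/varidealP => m /forallP Z'm; apply: fZ.
apply/forallP => i; apply/implyP => Zi.
exact: (implyP (Z'm i)) (ZZ' i Zi).
Qed.

Lemma varideal_sub (Z : pred 'I_n) P f :
  is_ideal P -> (forall i, Z i -> P 'X_i) -> varideal Z f -> P f.
Proof.
move=> IP ZP /varidealP fZ; rewrite [f]mpolyE; apply: ideal_sum => // m mf _.
apply: ideal_scale => //; have [/fZ fm|] := boolP (avoids Z m).
  by rewrite mcoeff_msupp fm eqxx in mf.
rewrite negb_forall => /existsP[i]; rewrite negb_imply -lep1mP => /andP[Zi mi].
by rewrite -(submK mi) mpolyXD; case: IP => _ [_]; apply; apply: ZP.
Qed.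

End Ideals.

(** * Length of chains of primes, bounded through algebraic dependence *)

Section Dimension.
Variables (K : fieldType) (n : nat).
Local Notation S := {mpoly K[n]}.
Implicit Types (f g : S) (y : nat -> S) (c : seq nat -> K).

Definition mdeg_le b f := forall m, m \in msupp f -> (mdeg m <= b)%N.

Lemma mdeg_leM b1 b2 f g : mdeg_le b1 f -> mdeg_le b2 g -> mdeg_le (b1 + b2) (f * g).
Proof.
move=> fb gb m /msupp_mulP[m1 [m2 [/fb m1b /gb m2b ->]]].
by rewrite mdegD leq_add.
Qed.

Lemma mdeg_leX b t f : mdeg_le b f -> mdeg_le (t * b) (f ^+ t).
Proof.
move=> fb; elim: t => [m|t IHt].
  by rewrite expr0 msupp1 inE => /eqP->; rewrite mdeg0.
by rewrite exprS mulSn; apply: mdeg_leM.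
Qed.

Lemma mdeg_leW b1 b2 f : (b1 <= b2)%N -> mdeg_le b1 f -> mdeg_le b2 f.
Proof. by move=> b12 fb m /fb /leq_trans; apply. Qed.

Lemma mdeg_le_sum b (T : Type) (s : seq T) (F : T -> S) :
  (forall t, mdeg_le b (F t)) -> mdeg_le b (\sum_(t <- s) F t).
Proof.
move=> Fb; elim/big_rec: _ => [m|t f _ fb m]; first by rewrite msupp0.
by move=> /msuppD_le; rewrite mem_cat => /orP[/Fb|/fb].
Qed.

(* [mval y D k j c] is the value at [y j, ..., y (j + k - 1)] of the polynomial
   in [k] variables with exponents below [D] and coefficient function [c]. *)
Fixpoint mval y (D k j : nat) c : S :=
  if k is k'.+1 then
    \sum_(t < D) y j ^+ t * mval y D k' j.+1 (fun s => c (val t :: s))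
  else (c [::])%:MP.

Definition exponents D k (s : seq nat) := (size s == k) && all (fun t => t < D)%N s.

Lemma mval_sum y D k j (T : finType) (v : T -> K) (d : T -> seq nat -> K) :
  mval y D k j (fun s => \sum_x v x * d x s) =
  \sum_x v x *: mval y D k j (d x).
Proof.
elim: k j d => [|k IHk] j d /=.
  rewrite raddf_sum; apply: eq_bigr => x _ /=.
  by rewrite mpolyCM mul_mpolyC.
under eq_bigr => t _ do rewrite IHk mulr_sumr.
rewrite exchange_big; apply: eq_bigr => x _ /=.
by rewrite scaler_sumr; apply: eq_bigr => t _; rewrite scalerAr.
Qed.

Lemma mval_eq0 y D k j c :
  (forall s, exponents D k s -> c s = 0) -> mval y D k j c = 0.
Proof.
elim: k j c => [|k IHk] j c c0 /=; first by rewrite c0 // mpolyC0.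
rewrite big1 // => t _; rewrite IHk ?mulr0 // => s /andP[sk sD].
by apply: c0; rewrite /exponents /= eqSS sk ltn_ord.
Qed.

Lemma mval_mdeg_le y D E N k j c :
  (forall i, (i < N)%N -> mdeg_le E (y i)) -> (j + k <= N)%N ->
  mdeg_le (k * (D * E)) (mval y D k j c).
Proof.
move=> yE; elim: k j c => [|k IHk] j c jk /=.
  move=> m; rewrite msuppC; case: ifP => // _.
  by rewrite inE => /eqP->; rewrite mdeg0.
rewrite mulSn; apply: mdeg_le_sum => t; apply: mdeg_leM.
  apply: (mdeg_leW _ (mdeg_leX (yE j _))); first by rewrite leq_mul2r ltnW ?orbT.
  by rewrite (leq_trans _ jk) // addnS ltnS leq_addr.
by apply: IHk; rewrite addSnnS.
Qed.

(** Linear algebra: for large [D] the products of powers of the n+1 elements with exponents below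
    [D] outnumber the monomials that can occur in them. *)
Lemma algebraic_dependence y :
  exists D c, (exists2 s, exponents D n.+1 s & c s != 0) /\
    mval y D n.+1 0 c = 0.
Proof.
pose E := (\sum_(i < n.+1) msize (y i))%N.
(* The products have degree at most [b], and (b+1)^n <= D^n ((n+1)E+1)^n < D^(n+1) by the choice of
   [D]. *)
pose D := ((n.+1 * E).+1 ^ n).+1; pose b := (n.+1 * (D * E))%N.
have yE i : (i < n.+1)%N -> mdeg_le E (y i).
  move=> ni m /msize_mdeg_lt /ltnW /leq_trans; apply.
  by rewrite /E (bigD1 (Ordinal ni)) //= leq_addr.
pose row := {: n.+1.-tuple 'I_D}; pose col := {: {ffun 'I_n -> 'I_b.+1}}.
pose dl (x : row) (s : seq nat) : K := (s == map val x)%:R.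
pose mon (g : col) : 'X_{1..n} := [multinom (g i : nat) | i < n].
pose M : 'M[K]_(#|row|, #|col|) :=
  \matrix_(i, l) (mval y D n.+1 0 (dl (enum_val i)))@_(mon (enum_val l)).
have lt_col_row : (#|col| < #|row|)%N.
  rewrite card_ffun card_tuple !card_ord expnSr.
  apply: (@leq_ltn_trans (D ^ n * (n.+1 * E).+1 ^ n)); last first.
    by rewrite ltn_pmul2l ?expn_gt0 // /D.
  have leq_exp k u w : (u <= w -> u ^ k <= w ^ k)%N.
    by move=> uw; elim: k => // k IHk; rewrite !expnS leq_mul.
  rewrite -expnMn; apply: leq_exp; rewrite /b; nia.
pose v := nz_row (kermx M).
have v_neq0 : v != 0.
  rewrite nz_row_eq0 -mxrank_eq0 mxrank_ker subn_eq0 -ltnNge.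
  exact: leq_ltn_trans (rank_leq_col M) lt_col_row.
have vM : v *m M = 0 by apply/sub_kermxP; apply: nz_row_sub.
have [i vi] : exists i, v 0 i != 0.
  apply/existsP; apply: contraR v_neq0; rewrite negb_exists => /forallP v0.
  by apply/eqP/rowP => i; rewrite mxE; apply/eqP; move: (v0 i); rewrite negbK.
exists D, (fun s => \sum_(x : row) v 0 (enum_rank x) * dl x s); split.
  exists (map val (enum_val i)).
    rewrite /exponents size_map size_tuple eqxx; apply/allP => _ /mapP[t _ ->].
    exact: ltn_ord.
  rewrite (bigD1 (enum_val i)) //= /dl eqxx mulr1 enum_valK big1 ?addr0 // => x xi.
  rewrite inj_eq; last exact: (inj_map val_inj).
  by rewrite (inj_eq val_inj) eq_sym (negPf xi) mulr0.
rewrite mval_sum; apply/mpolyP => m; rewrite mcoeff0.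
have [mb|mb] := leqP (mdeg m) b; last first.
  apply: memN_msupp_eq0; apply/negP.
  suff /[apply] : mdeg_le b (\sum_x v 0 (enum_rank x) *: mval y D n.+1 0 (dl x)).
    by rewrite leqNgt mb.
  apply: mdeg_le_sum => x u /msuppZ_le; exact: (@mval_mdeg_le y D E n.+1 n.+1 0 (dl x) yE (leqnn _)).
have mi i0 : (m i0 < b.+1)%N.
  by rewrite ltnS (leq_trans _ mb) // mdegE (bigD1 i0) //= leq_addr.
pose g : col := [ffun i0 => Ordinal (mi i0)].
have mg : m = mon g by apply/mnmP => i0; rewrite mnmE ffunE.
rewrite linear_sum /= (reindex (@enum_val _ row)); last first.
  by exists enum_rank => x _; rewrite ?enum_valK ?enum_rankK.
transitivity ((v *m M) 0 (enum_rank g)); last by rewrite vM mxE.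
by rewrite mxE; apply: eq_bigr => l _; rewrite mxE enum_valK enum_rankK -mg mcoeffZ.
Qed.

(** Induction on [k]: divide by the least power of [y j] that occurs. As [p j] is prime and omits
    [y j], it contains the cofactor; modulo [y j], which lies in [p j.+1], the cofactor is a nonzero
    expression in the remaining elements. *)
Lemma mval_notin (p : nat -> S -> Prop) d y D k j c :
  (forall i, (i <= d)%N -> is_prime (p i)) ->
  (forall i, (i < d)%N -> [/\ forall f, p i f -> p i.+1 f, p i.+1 (y i) & ~ p i (y i)]) ->
  (j + k = d)%N -> (exists2 s, exponents D k s & c s != 0) ->
  ~ p j (mval y D k j c).
Proof.
move=> pp py; elim: k j c => [|k IHk] j c jk [s].
  rewrite /exponents; case: s => // _ c0 /= pjc.
  have [[_ [_ pM]] [p1 _]] := pp j ltac:(lia).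
  by apply: p1; rewrite -mpolyC1 -(mulVf c0) mpolyCM; apply: pM.
case: s => // t0 s /andP[]; rewrite eqSS /= => sk /andP[t0D sD] cs pj.
have jd : (j < d)%N by lia.
have [pjS ySj yj] := py j jd.
have [Ip [p1 pM]] := pp j (ltnW jd); have [Ip' [p1' pM']] := pp j.+1 jd.
have [_ [_ ipM']] := Ip'; have [_ [ipD' _]] := Ip'.
pose nz t := exists2 s, exponents D k s & c (t :: s) != 0.
have ex_t : exists t, (t < D)%N /\ nz t.
  by exists t0; split=> //; exists s => //; rewrite /exponents sk sD.
have [t [tD tnz tmin]] : exists t, [/\ (t < D)%N, nz t & forall u, (u < t)%N -> ~ nz u].
  case: ex_t => t; elim/ltn_ind: t => t IHt [tD tnz].
  have [[u [ut unz]]|nou] := classic (exists u, (u < t)%N /\ nz u).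
    by apply: (IHt u) => //; split=> //; apply: ltn_trans tD.
  by exists t; split=> // u ut unz; apply: nou; exists u.
pose R u := mval y D k j.+1 (fun s => c (u :: s)).
have Ru0 u : (u < t)%N -> R u = 0.
  move=> ut; apply: mval_eq0 => s' s'D; apply/eqP/negPn/negP => cs'.
  by apply: (tmin u ut); exists s'.
(* Terms with exponent below [t] vanish, and those above [t] keep one more factor [y j]. *)
have pjE : mval y D k.+1 j c =
    y j ^+ t * (R t + y j * \sum_(u < D | (t < u)%N) y j ^+ (u - t.+1) * R u).
  rewrite /= (bigID (fun u : 'I_D => (u < t)%N)) /= big1 ?add0r; last first.
    by move=> u ut; rewrite -/(R u) Ru0 ?mulr0.
  rewrite (bigD1 (Ordinal tD)) ?ltnn //= -/(R t) mulrDr; congr (_ + _).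
  rewrite mulr_sumr mulr_sumr; apply: eq_big => [u|u /andP[ut neq_ut]].
    by rewrite -val_eqE /=; lia.
  rewrite -/(R u) !mulrA -exprSr -exprD; congr (_ ^+ _ * _).
  by move: neq_ut; rewrite -val_eqE /=; lia.
have {}pj : p j (mval y D k.+1 j c) := pj.
move: pj; rewrite pjE => /pM[].
  elim: t {tD tnz tmin Ru0 pjE} => [|u IHu]; first by rewrite expr0.
  by rewrite exprS => /pM[].
move=> /pjS pjR; have nR : ~ p j.+1 (R t) by apply: IHk => //; lia.
apply: nR; set r := \sum_(u < D | _) _ in pjR.
rewrite -(addrK (y j * r) (R t)); apply: ipD' => //.
by apply: ideal_opp => //; rewrite mulrC; apply: ipM'.
Qed.

(** If d > n, pick [y i] in [p i.+1] outside [p i]. A relation among the first n+1 of them has value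
    0, which lies in [p 0], against [mval_notin]. *)
Theorem prime_chain_length (p : nat -> S -> Prop) d :
  prime_chain p d -> (d <= n)%N.
Proof.
move=> [pp ps]; rewrite leqNgt; apply/negP => nd.
have [y py] : exists y, forall i, (i < d)%N -> p i.+1 (y i) /\ ~ p i (y i).
  exists (fun i => epsilon (inhabits 0) (fun f => p i.+1 f /\ ~ p i f)) => i id.
  by apply (epsilon_spec (inhabits (0 : S)) (fun f => p i.+1 f /\ ~ p i f)); case: (ps i id).
have [D [c [cs c0]]] := algebraic_dependence y.
apply: (@mval_notin p n.+1 y D n.+1 0 c) => //.
- by move=> i ni; apply: pp; apply: leq_trans nd.
- move=> i ni; have id := leq_trans ni nd; have [? ?] := py i id.
  by split=> //; case: (ps i id).
- by rewrite c0; case: (pp 0%N (leq0n _)) => [[]].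
Qed.

End Dimension.

(** * Initial forms and their coefficients *)

Section InitialForms.
Variables (K : fieldType) (n : nat).
Implicit Types (f : {mpoly K[n]}).

Lemma low_deg_le f m : m \in msupp f -> (low_deg f <= mdeg m)%N.
Proof.
rewrite /low_deg; move: (mdeg (head _ _)) => d.
elim: (msupp f) => // v s IHs; rewrite inE big_cons => /predU1P[->|/IHs].
  exact: geq_minl.
by apply: leq_trans; apply: geq_minr.
Qed.

Lemma initial_form_coef f m :
  (initial_form f)@_m = if mdeg m == low_deg f then f@_m else 0.
Proof.
rewrite /initial_form raddf_sum /=.
have [mf|mf] := boolP (m \in msupp f).
  rewrite big_mkcond (bigD1_seq m) ?msupp_uniq //= big1 ?addr0; last first.
    by move=> u um; case: ifP => // _; rewrite mcoeffZ mcoeffX (negPf um) mulr0.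
  by case: ifP => // _; rewrite mcoeffZ mcoeffX eqxx mulr1.
rewrite (memN_msupp_eq0 mf) if_same big_seq_cond big1 // => u /andP[uf _].
rewrite mcoeffZ mcoeffX; case: eqP => [um|_]; last by rewrite mulr0.
by rewrite -um uf in mf.
Qed.

Lemma low_degE f d :
  (forall m, m \in msupp f -> (d <= mdeg m)%N) ->
  (exists2 m, m \in msupp f & mdeg m = d) -> low_deg f = d.
Proof.
move=> fd [m mf md]; apply/eqP; rewrite eqn_leq -{1}md low_deg_le //=.
(* The default value of the minimum is the degree of the first monomial in the support, so it obeys
   the same lower bound. *)
rewrite /low_deg; have: (d <= mdeg (head 0%MM (msupp f)))%N.
  by apply: fd; case: (msupp f) mf => //= v s _; rewrite mem_head.
move: (mdeg (head _ _)) => d0 dd0; rewrite big_seq.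
by elim/big_ind: _ => // x y xd yd; rewrite leq_min xd.
Qed.

End InitialForms.

(** * Weights, irreducible monomials and the equations of the tangent cone *)

Section Weights.
Variables (n : nat) (a : 'I_n -> nat).
Implicit Types (m u v w : 'X_{1..n}).

(** The exponent of t in the image of ['X_[m]] in K[H]. *)
Definition weight m := (\sum_i m i * a i)%N.

Lemma wtD m v : weight (m + v)%MM = (weight m + weight v)%N.
Proof.
by rewrite /weight -big_split; apply: eq_bigr => i _; rewrite mnmDE mulnDl.
Qed.

Lemma wt0 : weight 0%MM = 0%N.
Proof. by rewrite /weight big1 // => i _; rewrite mnm0E. Qed.

Lemma wtU i : weight U_(i)%MM = a i.
Proof.
rewrite /weight (bigD1 i) //= mnm1E eqxx mul1n big1 ?addn0 // => j ji.
by rewrite mnm1E eq_sym (negPf ji).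
Qed.

Lemma wtMn m k : weight (m *+ k)%MM = (weight m * k)%N.
Proof.
elim: k => [|k IHk]; first by rewrite mulm0n muln0 wt0.
by rewrite mulmS wtD IHk mulnS.
Qed.

Lemma wt_mapE (K : fieldType) m :
  mmap1 (fun i => 'X^(a i) : {poly K}) m = 'X^(weight m).
Proof.
rewrite /mmap1 /weight -prodrXr; apply: eq_bigr => i _.
by rewrite mulnC exprM.
Qed.

Lemma toric_idealP (K : fieldType) (f : {mpoly K[n]}) :
  toric_ideal a f <-> forall h, \sum_(m <- msupp f | weight m == h) f@_m = 0.
Proof.
have coefE h : (mmap (@polyC K) (fun i => 'X^(a i)) f)`_h =
    \sum_(m <- msupp f | weight m == h) f@_m.
  rewrite /mmap coef_sum [RHS]big_mkcond; apply: eq_bigr => m _.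
  by rewrite wt_mapE coefCM coefXn eq_sym; case: eqP => _; rewrite ?mulr1 ?mulr0.
split=> [f0 h|f0]; first by rewrite -coefE f0 coef0.
by apply/polyP => h; rewrite coefE f0 coef0.
Qed.

Hypothesis a_gt0 : forall i, (0 < a i)%N.

Lemma mdeg_le_wt m : (mdeg m <= weight m)%N.
Proof.
by rewrite mdegE /weight; apply: leq_sum => i _; rewrite leq_pmulr.
Qed.

(** Positive generators bound the degree by the weight, so the maximum runs over a finite type of
    bounded monomials. *)
Definition normal_form m : 'X_{1..n} :=
  [arg max_(v > BMultinom (mdeg_le_wt m : mdeg m < (weight m).+1)%N | weight v == weight m)
     (v : 'X_{1..n})]%O.

Lemma nf_wt m : weight (normal_form m) = weight m.
Proof. by rewrite /normal_form; case: arg_maxP => //= v /eqP. Qed.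

Lemma nf_max m v : weight v = weight m -> (v <= normal_form m)%O.
Proof.
rewrite /normal_form; case: arg_maxP => //= u _ umax vm.
have vb : (mdeg v < (weight m).+1)%N by rewrite -vm ltnS mdeg_le_wt.
by apply: (umax (BMultinom vb)); rewrite /= vm.
Qed.

Lemma nf_ge m : (m <= normal_form m)%O. Proof. exact: nf_max. Qed.

Lemma nf_eq u v : weight u = weight v -> normal_form u = normal_form v.
Proof. by move=> uv; apply/le_anti; rewrite !nf_max ?nf_wt. Qed.

(* The irreducible monomials are the standard ones with respect to the initial
   ideal of the tangent cone: the built-in order on monomials compares the
   degrees first and breaks ties lexicographically, in the direction opposite
   to the degree reverse lexicographic order. *)
Definition irreducible m := normal_form m == m.

Lemma irr_nf m : irreducible (normal_form m).
Proof. by rewrite /irreducible; apply/eqP/nf_eq/nf_wt. Qed.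

Lemma irr_max u v : irreducible u -> weight v = weight u -> (v <= u)%O.
Proof. by move=> /eqP{2}<-; apply: nf_max. Qed.

Lemma irrP u : (forall v, weight v = weight u -> (v <= u)%O) -> irreducible u.
Proof.
by move=> umax; apply/eqP/le_anti; rewrite nf_ge umax ?nf_wt.
Qed.

Lemma irr_mdeg u v : irreducible u -> weight v = weight u -> (mdeg v <= mdeg u)%N.
Proof. by move=> iu vu; apply/lemc_mdeg/irr_max. Qed.

Lemma irr_inj u v : irreducible u -> irreducible v -> weight u = weight v -> u = v.
Proof. by move=> /eqP iu /eqP iv uv; rewrite -iu -iv; apply: nf_eq. Qed.

(** The order is compatible with multiplication, so anything beating [u] would beat [u + w] after
    multiplication by [w]. *)
Lemma irr_sub u w : irreducible (u + w)%MM -> irreducible u.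
Proof.
move=> iuw; apply: irrP => v vu.
by rewrite -(lemc_add2l _ _ w); apply: irr_max => //; rewrite !wtD vu.
Qed.

Lemma irr_lem u v : (u <= v)%MM -> irreducible v -> irreducible u.
Proof. by move=> uv; rewrite -(submK uv) addmC; apply: irr_sub. Qed.

Lemma mdeg2P m : mdeg m = 2%N -> exists k l, m = (U_(k) + U_(l))%MM.
Proof.
move=> m2; have [k mk] : exists k, m k != 0%N.
  apply/existsP; apply: contra_eqT m2; rewrite negb_exists => /forallP m0.
  by rewrite mdegE big1 // => i _; apply/eqP; move: (m0 i); rewrite negbK.
rewrite -lep1mP in mk; have /eqP : mdeg (m - U_(k))%MM = 1%N.
  by move: m2; rewrite -{1}(submK mk) mdegD mdeg1; lia.
by move=> /mdeg1P[l /eqP ml]; exists l, k; rewrite -ml submK.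
Qed.

Section TangentCone.
Variable K : fieldType.
Local Notation S := {mpoly K[n]}.
Local Notation I := (@tangent_ideal K n (toric_ideal a)).
Implicit Types (f g : S).

Lemma tangent_is_ideal : is_ideal I.
Proof. exact: gen_ideal_is_ideal. Qed.

(* [X_m] maps to [t^(weight m)] in the associated graded ring when [mdeg m] is
   the order of [weight m], and to [0] otherwise: these equations describe the
   kernel. *)
Definition gr_eq0 f := forall u, irreducible u ->
  \sum_(m <- msupp f | (weight m == weight u) && (mdeg m == mdeg u)) f@_m = 0.

(** Test on ['X_[w]] times the initial form of [g]. As [u] has the largest degree in its weight, the
    terms of [g] in the weight concerned all have degree [low_deg g]; the sum is then a whole weight
    component of [g], which vanishes. *)
Lemma tangent_gr_eq0 f : I f -> gr_eq0 f.
Proof.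
move=> If u iu; rewrite -mlin_indicator; apply: mlin_gen_ideal If.
move=> _ w [g [Ig [g0 ->]]].
set Q := fun m => (weight (m + w)%MM == weight u) && (mdeg (m + w)%MM == mdeg u).
rewrite (_ : mlin _ _ = mlin (fun m => (Q m && (mdeg m == low_deg g))%:R) g); last first.
  rewrite !(mlinE _ (k := maxn (msize g) (msize (initial_form g)))) ?leq_maxl ?leq_maxr //.
  apply: eq_bigr => m _; rewrite initial_form_coef /Q; case: eqP => _.
    by rewrite andbT.
  by rewrite andbF mul0r mulr0.
rewrite mlin_indicator.
(* Either no lowest monomial is carried by [w] to the weight and degree of [u], and the sum is
   empty, or [m0] singles out the weight component. *)
have [/existsP[m0 /andP[]]|noQ] := boolP [exists m0 : 'X_{1..n < (low_deg g).+1},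
    Q m0 && (mdeg m0 == low_deg g)]; last first.
  rewrite big_pred0 // => m; apply: contraNF noQ => /andP[Qm /eqP md].
  have mb : (mdeg m < (low_deg g).+1)%N by rewrite md.
  by apply/existsP; exists (BMultinom mb); rewrite /= Qm md eqxx.
rewrite /Q => /andP[/eqP m0wt /eqP m0deg] /eqP m0low.
move/toric_idealP: Ig => /(_ (weight m0)) Ig; rewrite -[RHS]Ig.
rewrite big_seq_cond [RHS]big_seq_cond; apply: eq_bigl => m.
have [mg /=|//] := boolP (m \in msupp g); rewrite /Q -m0wt !wtD eqn_add2r.
have [mm0 /=|//] := eqVneq (weight m) (weight m0).
have mdeg_m : mdeg m = low_deg g.
  apply/eqP; rewrite eqn_leq low_deg_le // andbT -m0low.
  by rewrite -(leq_add2r (mdeg w)) -!mdegD m0deg irr_mdeg // -m0wt !wtD mm0.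
by rewrite -m0deg !mdegD mdeg_m m0low !eqxx.
Qed.

Lemma toric_binomial u v : weight u = weight v -> toric_ideal a ('X_[u] - 'X_[v] : S).
Proof. by move=> uv; rewrite /toric_ideal mmapB !mmapX !wt_mapE uv subrr. Qed.

Lemma msupp_binomial u v m :
  u != v -> (m \in msupp ('X_[u] - 'X_[v] : S)) = (m == u) || (m == v).
Proof.
move=> neq_uv; rewrite mcoeff_msupp mcoeffB !mcoeffX (eq_sym u) (eq_sym v).
have [->|_] := eqVneq m u; first by rewrite (negPf neq_uv) subr0 oner_eq0.
by rewrite sub0r oppr_eq0; case: (m == v); rewrite ?eqxx ?oner_eq0.
Qed.

Lemma tangent_monomial u v :
  weight u = weight v -> (mdeg u < mdeg v)%N -> I 'X_[u].
Proof.
move=> uv duv; have neq_uv : u != v by apply: contraTneq duv => ->; rewrite ltnn.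
have lowE : low_deg ('X_[u] - 'X_[v] : S) = mdeg u.
  apply: low_degE => [m|]; rewrite ?msupp_binomial //.
    by case/orP=> /eqP-> //; apply: ltnW.
  by exists u; rewrite ?msupp_binomial ?eqxx.
apply: gen_ideal_sub; exists ('X_[u] - 'X_[v]); split; last split.
- exact: toric_binomial.
- by rewrite -msupp_eq0; apply/eqP => /(congr1 (fun s => u \in s)); rewrite msupp_binomial // eqxx.
apply/mpolyP => m; rewrite initial_form_coef lowE mcoeffB !mcoeffX.
have [<-|um] := eqVneq u m; first by rewrite eqxx eq_sym (negPf neq_uv) subr0.
have [<-|_] := eqVneq v m; last by rewrite subr0 if_same.
by rewrite gtn_eqF.
Qed.

Lemma tangent_binomial u v :
  weight u = weight v -> mdeg u = mdeg v -> I ('X_[u] - 'X_[v]).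
Proof.
move=> uv duv; have [->|neq_uv] := eqVneq u v.
  by rewrite subrr; case: tangent_is_ideal.
have lowE : low_deg ('X_[u] - 'X_[v] : S) = mdeg u.
  apply: low_degE => [m|]; rewrite ?msupp_binomial //.
    by case/orP=> /eqP-> //; rewrite duv.
  by exists u; rewrite ?msupp_binomial ?eqxx.
apply: gen_ideal_sub; exists ('X_[u] - 'X_[v]); split; last split.
- exact: toric_binomial.
- by rewrite -msupp_eq0; apply/eqP => /(congr1 (fun s => u \in s)); rewrite msupp_binomial // eqxx.
apply/mpolyP => m; rewrite initial_form_coef lowE mcoeffB !mcoeffX.
have [<-|um] := eqVneq u m; first by rewrite eqxx.
have [<-|_] := eqVneq v m; last by rewrite subrr if_same.
by rewrite duv eqxx.
Qed.

(** The class of ['X_[m]] in the tangent cone, which is zero when its weight is attained in a larger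
    degree. *)
Definition normal_tail m : S := if mdeg (normal_form m) == mdeg m then 'X_[normal_form m] else 0.
Definition normal_relation m : S := 'X_[m] - normal_tail m.

Lemma nf_rel_tangent m : I (normal_relation m).
Proof.
rewrite /normal_relation /normal_tail; case: eqP => [md|/eqP md].
  by apply: tangent_binomial; rewrite ?nf_wt.
rewrite subr0; apply: (@tangent_monomial m (normal_form m)); rewrite ?nf_wt //.
by rewrite ltn_neqAle eq_sym md lemc_mdeg ?nf_ge.
Qed.

Lemma nf_rel_irr m : irreducible m -> normal_relation m = 0.
Proof. by move=> /eqP im; rewrite /normal_relation /normal_tail im eqxx subrr. Qed.

(** The tails collected at an irreducible monomial add up to the sum that [gr_eq0] makes zero. With
    [tangent_gr_eq0], the normal relations thus span the ideal over K. *)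
Lemma gr_eq0_span f : gr_eq0 f -> f = \sum_(m <- msupp f) f@_m *: normal_relation m.
Proof.
move=> f0; under eq_bigr => m _ do rewrite scalerBr.
rewrite sumrB -mpolyE [X in f - X](_ : _ = 0) ?subr0 //.
apply/mpolyP => v; rewrite mcoeff0 raddf_sum /=.
have [iv|niv] := boolP (irreducible v).
  rewrite -[RHS](f0 v iv) [RHS]big_mkcond; apply: eq_bigr => m _.
  rewrite mcoeffZ /normal_tail.
  have [mv /=|mv /=] := eqVneq (weight m) (weight v).
    have -> : normal_form m = v by apply: irr_inj; rewrite ?irr_nf ?nf_wt.
    by rewrite eq_sym; case: ifP => _; rewrite ?mcoeffX ?eqxx ?mcoeff0 ?mulr1 ?mulr0.
  case: ifP => _; rewrite ?mcoeff0 ?mulr0 // mcoeffX.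
  case: eqP => [mv'|_]; last by rewrite mulr0.
  by rewrite -mv' nf_wt eqxx in mv.
apply: big1 => m _; rewrite mcoeffZ /normal_tail; case: ifP => _; rewrite ?mcoeff0 ?mulr0 //.
rewrite mcoeffX; case: eqP => [mv|_]; rewrite ?mulr0 //.
by rewrite -mv irr_nf in niv.
Qed.

Lemma nf_rel_coef_irr m u : ~~ irreducible u -> (normal_relation m)@_u = (m == u)%:R.
Proof.
move=> niu; rewrite /normal_relation /normal_tail mcoeffB mcoeffX.
case: ifP => _; rewrite ?mcoeff0 ?subr0 // mcoeffX.
case: (normal_form m =P u) => [mu|_]; rewrite ?subr0 //.
by rewrite -mu irr_nf in niu.
Qed.

Lemma nf_rel_homogeneous m : homogeneous (mdeg m) (normal_relation m).
Proof.
move=> v /msuppB_le; rewrite mem_cat msuppX inE => /orP[/eqP->//|].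
rewrite /normal_tail; case: ifP => [/eqP<-|_]; last by rewrite msupp0.
by rewrite msuppX inE => /eqP->.
Qed.

End TangentCone.
End Weights.

(** * Consequences of Cohen-Macaulayness and of generation by quadrics *)

Section Quadratic.
Variables (K : fieldType) (n0 : nat) (a : 'I_n0.+1 -> nat).
Hypothesis a_gt0 : forall i, (0 < a i)%N.
Hypothesis a_mono : forall i j : 'I_n0.+1, (i < j)%N -> (a i < a j)%N.
Hypothesis a_min : forall m i, weight a m = a i -> m = U_(i)%MM.
Local Notation S := {mpoly K[n0.+1]}.
Local Notation I := (@tangent_ideal K n0.+1 (toric_ideal a)).
Local Notation wt := (weight a).
Local Notation nf := (normal_form a_gt0).
Local Notation irr := (irreducible a_gt0).
Local Notation nf_rel := (normal_relation a_gt0 K).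
Implicit Types (f g : S) (m u v w : 'X_{1..n0.+1}) (i j k : 'I_n0.+1).

Lemma a_inj : injective a.
Proof.
move=> i j aij; apply: val_inj => /=.
by case: (ltngtP i j) => // /a_mono; rewrite aij ltnn.
Qed.

Lemma a0_lt i : i != ord0 -> (a ord0 < a i)%N.
Proof. by move=> i0; apply: a_mono; rewrite lt0n. Qed.

Lemma a0_le i : (a ord0 <= a i)%N.
Proof. by have [->|/a0_lt/ltnW] := eqVneq i ord0. Qed.

Lemma irr0 : irr 0%MM.
Proof.
apply: irrP => v; rewrite wt0 => v0; have := mdeg_le_wt a_gt0 v.
by rewrite v0 leqn0 mdeg_eq0 => /eqP->.
Qed.

Lemma irrU i : irr U_(i)%MM.
Proof. by apply: irrP => v; rewrite wtU => /a_min->. Qed.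

(** As x_1 alone has least weight, any other variable in [m] would make the weight exceed
    [mdeg m * a ord0]. *)
Lemma x0_power_unique m t :
  wt m = (t * a ord0)%N -> (t <= mdeg m)%N -> m = (U_(ord0) *+ t)%MM.
Proof.
move=> mt tm; have m_eq0 i : i != ord0 -> m i = 0%N.
  move=> i0; apply/eqP; rewrite -leqn0 leqNgt; apply/negP => mi.
  suff : (mdeg m * a ord0 < wt m)%N.
    by rewrite mt ltn_pmul2r // ltnNge tm.
  rewrite mdegE big_distrl /= /weight (bigD1 i) //= [X in (_ < X)%N](bigD1 i) //=.
  rewrite -addSn leq_add ?ltn_pmul2l ?a0_lt //.
  by apply: leq_sum => j _; rewrite leq_mul2l a0_le orbT.
have m0 : m ord0 = t.
  have wtm : wt m = (m ord0 * a ord0)%N.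
    by rewrite /weight (bigD1 ord0) //= big1 ?addn0 // => i /m_eq0->.
  by move/eqP: mt; rewrite wtm eqn_pmul2r // => /eqP.
apply/mnmP => i; rewrite mulmnE mnm1E.
by have [<-|i0] := eqVneq ord0 i; rewrite ?mul1n // mul0n m_eq0 // eq_sym.
Qed.

Lemma irr_x0_power t : irr (U_(ord0) *+ t)%MM.
Proof.
apply: irrP => v; rewrite wtMn wtU mulnC => vt.
have [tv|tv] := leqP t (mdeg v); first by rewrite (x0_power_unique vt tv).
by apply/ltW/lt_mdeg_ltmc; rewrite mdegMn mdeg1 mul1n.
Qed.

(** A power of x_1 is irreducible and alone in its weight and degree, so its coefficient in [f] is
    itself one of the vanishing sums. *)
Lemma tangent_varideal f : I f -> varideal (predC1 ord0) f.
Proof.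
move=> /tangent_gr_eq0 f0; apply/varidealP => m /forallP mZ.
have mE : m = (U_(ord0) *+ m ord0)%MM.
  apply/mnmP => i; rewrite mulmnE mnm1E.
  have [<-|i0] := eqVneq ord0 i; first by rewrite mul1n.
  by rewrite mul0n; apply/eqP; apply: (implyP (mZ i)); rewrite /= eq_sym.
have im : irr m by rewrite mE irr_x0_power.
rewrite -[RHS](f0 a_gt0 m im) -mlin_coeff mlin_indicator.
apply: eq_bigl => v; apply/eqP/andP => [->|[/eqP vm /eqP dvm]]; first by rewrite !eqxx.
rewrite [RHS]mE; apply: x0_power_unique; first by rewrite vm mE wtMn wtU mulmnE mnm1E eqxx mul1n mulnC.
by rewrite dvm mdegE (bigD1 ord0) //= leq_addr.
Qed.

Lemma mdeg_irrelevant_power g t m :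
  irrelevant g -> m \in msupp (g ^+ t) -> (t <= mdeg m)%N.
Proof.
move=> g0; elim: t m => // t IHt m; rewrite exprS => /msupp_mulP[m1 [m2 [m1g /IHt m2t ->]]].
rewrite mdegD -add1n leq_add // lt0n mdeg_eq0; apply: contraTneq m1g => ->.
by rewrite mcoeff_msupp g0 eqxx.
Qed.

Lemma tangent_Xpower i : i != ord0 -> I 'X_[U_(i) *+ a ord0].
Proof.
move=> i0; apply: (@tangent_monomial _ _ _ _ (U_(ord0) *+ a i)).
  by rewrite !wtMn !wtU mulnC.
by rewrite !mdegMn !mdeg1 !mul1n a0_lt.
Qed.

Lemma tangent_XM m u : (u <= m)%MM -> I 'X_[u] -> I 'X_[m].
Proof.
move=> um Iu; rewrite -(submK um) mpolyXD.
by case: (tangent_is_ideal a K) => _ [_]; apply.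
Qed.

(** Pigeonhole: if x_1 is absent, some exponent reaches [a ord0], and [tangent_Xpower] applies. *)
Lemma tangent_high_degree m :
  (n0.+1 * a ord0 <= mdeg m)%N -> m ord0 != 0%N \/ I 'X_[m].
Proof.
move=> md; have [m0|] := eqVneq (m ord0) 0%N; [right | by left].
have [/existsP[i mi]|/existsPn noi] := boolP [exists i, (a ord0 <= m i)%N].
  have i0 : i != ord0.
    by apply: contraTneq mi => ->; rewrite m0 -ltnNge.
  apply: tangent_XM (tangent_Xpower i0); apply/mnm_lepP => j.
  by rewrite mulmnE mnm1E; case: eqP => [<-|]; rewrite ?mul1n ?mul0n.
suff : (mdeg m < n0.+1 * a ord0)%N by rewrite ltnNge md.
rewrite mdegE; apply: (@leq_ltn_trans (\sum_(i < n0.+1) (a ord0).-1)).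
  by apply: leq_sum => i _; move: (noi i); rewrite -ltnNge; case: (a ord0).
by rewrite sum_nat_const card_ord ltn_pmul2l // prednK.
Qed.

Section CohenMacaulay.
Hypothesis cm : cohen_macaulay_quot I.

(** Cohen-Macaulayness is applied to the chain (x_2, ..., x_n) < (x_1, ..., x_n) of length 1. *)
Lemma exists_regular : exists2 g, irrelevant g & forall f, I (g * f) -> I f.
Proof.
pose c t : S -> Prop := if t is 0%N then varideal (predC1 ord0) else varideal predT.
have chain_c : prime_chain c 1.
  split=> [[|t] _|[|t] // _]; [exact: varideal_prime.. | split=> [f|]].
    exact: varideal_mono.
  by exists 'X_(ord0); split; [apply/varidealX | move=> /varidealX].
have [s [s1 [s_irr [_ s_reg]]]] := cm chain_c tangent_varideal.
case: s s1 s_irr s_reg => // g [] // _ s_irr s_reg.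
exists g; first by apply: s_irr; rewrite mem_head.
move=> f Igf; have II := tangent_is_ideal a K.
by apply/(ideal_plus_seq_nil _ II)/(s_reg 0%N) => //=; apply/(ideal_plus_seq_nil _ II).
Qed.

(** In a high power of the regular element [g] every monomial lies in the ideal or is divisible by
    x_1, so that power multiplies [f] into the ideal; then cancel [g] repeatedly. *)
Lemma x0_regular f : I ('X_(ord0) * f) -> I f.
Proof.
have [g g0 greg] := exists_regular; have II := tangent_is_ideal a K.
have [_ [_ IM]] := II => Ixf.
suff : I (g ^+ (n0.+1 * a ord0) * f).
  elim: (n0.+1 * a ord0)%N => [|t IHt]; first by rewrite expr0 mul1r.
  by rewrite exprS -mulrA => /greg.
rewrite [g ^+ _]mpolyE mulr_suml; apply: ideal_sum => // m mg _.
rewrite -scalerAl; apply: ideal_scale => //.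
have [|Im] := tangent_high_degree (mdeg_irrelevant_power g0 mg); last by rewrite mulrC; apply: IM.
by rewrite -lep1mP => m0; rewrite -(submK m0) mpolyXD -mulrA; apply: IM.
Qed.

Lemma monomial_tangentN u : irr u -> ~ I 'X_[u].
Proof.
move=> iu Iu; have := tangent_gr_eq0 Iu iu; rewrite msuppX big_mkcond big_seq1 !eqxx /= mcoeffX eqxx.
by move/eqP; rewrite oner_eq0.
Qed.

Lemma le_head u v : mdeg u = mdeg v -> (u <= v)%O -> (u ord0 <= v ord0)%N.
Proof.
move=> duv; rewrite le_eqVlt => /predU1P[->//|/(ltmcP duv)[i eq_lt lt_i]].
have [i0|i0] := eqVneq i ord0; first by rewrite -i0 ltnW.
by rewrite eq_lt // lt0n.
Qed.

(** A better monomial of larger degree would put x_1 u, hence u, in the ideal. One of equal degree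
    is divisible by x_1, and cancelling x_1 contradicts the irreducibility of [u]. *)
Lemma irr_x0 u : irr u -> irr (U_(ord0) + u)%MM.
Proof.
move=> iu; apply: irrP => v vu; rewrite leNgt; apply/negP => uv.
have := lemc_mdeg (ltW uv); rewrite leq_eqVlt => /predU1P[duv|duv]; last first.
  apply: (monomial_tangentN iu); apply: x0_regular; rewrite -mpolyXD.
  exact: tangent_monomial duv.
have := le_head duv (ltW uv); rewrite mnmDE mnm1E eqxx add1n => v0.
have v0' : (U_(ord0) <= v)%MM by rewrite lep1mP -lt0n (leq_trans _ v0).
move: uv vu; rewrite -(submK v0') addmC ltmc_add2l => uv.
rewrite !wtD => wvu; have {wvu}/(irr_max iu) : wt (v - U_(ord0))%MM = wt u by lia.
by rewrite leNgt uv.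
Qed.

Lemma irr_x0_powerM t u : irr u -> irr (U_(ord0) *+ t + u)%MM.
Proof.
move=> iu; elim: t => [|t IHt]; first by rewrite mulm0n add0m.
by rewrite mulmS -addmA irr_x0.
Qed.

End CohenMacaulay.

Section QuadraticRelations.
Hypothesis quadratic : exists Q : S -> Prop,
  (forall q, Q q -> homogeneous 2 q) /\ ideal_eq (gen_ideal Q) I.

(** Suppose x_i^2 is irreducible. A term x_k x_l of the same weight with k < i would be larger in
    the order, so x_i^2 is alone in its weight and its coefficient vanishes in every quadric. *)
Lemma square_reducible i : i != ord0 -> ~~ irr (U_(i) + U_(i))%MM.
Proof.
move=> i0; apply/negP => ii; have [Q [Qhom QI]] := quadratic.
have Qi q : Q q -> q@_(U_(i) + U_(i)) = 0.
  move=> Qq; have Iq : I q by apply/QI/gen_ideal_sub.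
  have := tangent_gr_eq0 Iq ii => <-; rewrite -mlin_coeff mlin_indicator.
  rewrite big_seq_cond [RHS]big_seq_cond; apply: eq_bigl => m.
  have [mq /=|//] := boolP (m \in msupp q).
  apply/eqP/andP => [->|[/eqP wtm /eqP dm]]; first by rewrite !eqxx.
  have [k [l mkl]] := mdeg2P (Qhom q Qq m mq).
  wlog kl : k l mkl / (k <= l)%N.
    by move=> wl; case/orP: (leq_total k l) => [/wl|/wl]; apply; rewrite // addmC.
  move: wtm; rewrite mkl !wtD !wtU => aa.
  have [ki|ik] := ltnP k i; last first.
    have aik : (a i <= a k)%N.
      by move: ik; rewrite leq_eqVlt => /predU1P[/val_inj->//|/a_mono/ltnW].
    have akl : (a k <= a l)%N.
      by move: kl; rewrite leq_eqVlt => /predU1P[/val_inj->//|/a_mono/ltnW].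
    have [-> ->] // : k = i /\ l = i by split; apply: a_inj; lia.
  have : (m <= (U_(i) + U_(i))%MM)%O by apply: irr_max => //; rewrite mkl !wtD !wtU.
  rewrite leNgt => /negP[]; apply/ltmcP => //.
  exists k => [j jk|]; rewrite mkl !mnmDE !mnm1E.
    have neq k' : (j < k')%N -> (k' == j) = false.
      by move=> jk'; apply/eqP => k'j; rewrite k'j ltnn in jk'.
    by rewrite !neq //; [exact: leq_trans jk kl | exact: ltn_trans ki].
  have -> : (i == k) = false by apply/eqP => ik; rewrite ik ltnn in ki.
  by rewrite eqxx.
(* The only degree 2 divisor of a power of x_i is x_i^2, so no element of the ideal could involve
   x_i^e, although x_i^e belongs to it. *)
have := tangent_Xpower i0 => /QI; set e := a ord0 => Xe.
suff : ('X_[U_(i) *+ e] : S)@_(U_(i) *+ e) = 0.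
  by rewrite mcoeffX eqxx => /eqP; rewrite oner_eq0.
rewrite -mlin_coeff; apply: mlin_gen_ideal Xe => q w Qq.
rewrite mlin_indicator big_seq_cond big1 // => m /andP[mq /eqP mw].
suff mE : m = (U_(i) + U_(i))%MM by rewrite mE Qi.
have md := Qhom q Qq m mq.
have m_eq0 j : j != i -> m j = 0%N.
  move=> ji; move/mnmP: mw => /(_ j); rewrite mnmDE mulmnE mnm1E eq_sym (negPf ji) mul0n.
  by move/eqP; rewrite addn_eq0 => /andP[/eqP].
have mi : m i = 2%N by rewrite -md mdegE (bigD1 i) //= big1 ?addn0 // => j /m_eq0.
apply/mnmP => j; rewrite mnmDE mnm1E; have [<-|ij] := eqVneq i j; first by rewrite mi.
by rewrite m_eq0 // eq_sym.
Qed.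

Lemma quadratic_span f :
  I f <-> gen_ideal (fun g => exists u, [/\ mdeg u = 2%N, ~~ irr u & g = nf_rel u]) f.
Proof.
have [Q [Qhom QI]] := quadratic; split; last first.
  apply: gen_ideal_min; first exact: tangent_is_ideal.
  by move=> _ [u [_ _ ->]]; apply: nf_rel_tangent.
move=> /QI; apply: gen_ideal_min; first exact: gen_ideal_is_ideal.
move=> q Qq; have Iq : I q by apply/QI/gen_ideal_sub.
rewrite (gr_eq0_span (tangent_gr_eq0 (a_gt0 := a_gt0) Iq)).
have II := @gen_ideal_is_ideal K n0.+1
  (fun g => exists u, [/\ mdeg u = 2%N, ~~ irr u & g = nf_rel u]).
apply: ideal_sum => // m mq _; apply: ideal_scale => //.
have [/nf_rel_irr->|niu] := boolP (irr m); first by case: II.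
by apply: gen_ideal_sub; exists m; rewrite (Qhom q Qq m mq).
Qed.

Lemma tangent_coef_low f m : I f -> (mdeg m < 2)%N -> f@_m = 0.
Proof.
have [Q [Qhom QI]] := quadratic => /QI If m2.
rewrite -mlin_coeff; apply: mlin_gen_ideal If => q w Qq.
rewrite mlin_indicator big_seq_cond big1 // => u /andP[uq /eqP uw].
by move: m2; rewrite -uw mdegD (Qhom q Qq u uq).
Qed.

End QuadraticRelations.
End Quadratic.

(** * Counting the irreducible monomials free of x_1 *)

Section Counting.
Variables (K : fieldType) (n0 : nat) (a : 'I_n0.+1 -> nat).
Hypothesis a_gt0 : forall i, (0 < a i)%N.
Hypothesis a_mono : forall i j : 'I_n0.+1, (i < j)%N -> (a i < a j)%N.
Hypothesis a_min : forall m i, weight a m = a i -> m = U_(i)%MM.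
Hypothesis a_residue : forall r, exists m, weight a m = r %[mod a ord0].
Local Notation S := {mpoly K[n0.+1]}.
Local Notation I := (@tangent_ideal K n0.+1 (toric_ideal a)).
Hypothesis cm : cohen_macaulay_quot I.
Hypothesis quadratic : exists Q : S -> Prop,
  (forall q, Q q -> homogeneous 2 q) /\ ideal_eq (gen_ideal Q) I.
Local Notation wt := (weight a).
Local Notation nf := (normal_form a_gt0).
Local Notation irr := (irreducible a_gt0).
Local Notation nf_rel := (normal_relation a_gt0 K).
Implicit Types (f g : S) (m u v w : 'X_{1..n0.+1}) (i j k : 'I_n0.+1).
Implicit Types (T : {set 'I_n0.+1}).

(** The exponent of x_1 is left unrestricted. *)
Definition squarefree m := [forall i, (i != ord0) ==> (m i <= 1)%N].

Lemma lem_double i m : (1 < m i)%N -> (U_(i) + U_(i) <= m)%MM.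
Proof.
move=> mi; apply/mnm_lepP => j; rewrite mnmDE mnm1E.
by have [<-|] := eqVneq i j.
Qed.

Lemma irr_squarefree m : irr m -> squarefree m.
Proof.
move=> im; apply/forallP => i; apply/implyP => i0; rewrite leqNgt; apply/negP => mi.
have := square_reducible a_gt0 a_mono quadratic i0.
by rewrite (irr_lem (lem_double mi)).
Qed.

Definition set_monomial T : 'X_{1..n0.+1} := [multinom (i \in T : nat) | i < n0.+1].

Lemma squarefreeE m : squarefree m ->
  exists2 T : {set 'I_n0.+1}, ord0 \notin T & m = (U_(ord0) *+ m ord0 + set_monomial T)%MM.
Proof.
move=> /forallP m1; exists [set i | (i != ord0) && (m i != 0%N)].
  by rewrite inE eqxx.
apply/mnmP => i; rewrite mnmDE mulmnE mnm1E mnmE inE.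
have [->|i0] := eqVneq i ord0; first by rewrite mul1n addn0.
by rewrite mul0n add0n; move: (implyP (m1 i) i0); case: (m i) => [|[|]].
Qed.

Lemma set_monomial_squarefree T : squarefree (set_monomial T).
Proof.
by apply/forallP => i; apply/implyP => _; rewrite mnmE; case: (i \in T).
Qed.

Definition standard_sets := [set T : {set 'I_n0.+1} | (ord0 \notin T) && irr (set_monomial T)].

(** Congruent weights become equal after multiplying one monomial by a power of x_1; this preserves
    irreducibility, and irreducible monomials are determined by their weight. *)
Lemma standard_sets_inj T1 T2 : T1 \in standard_sets -> T2 \in standard_sets ->
  wt (set_monomial T1) = wt (set_monomial T2) %[mod a ord0] -> T1 = T2.
Proof.
wlog le12 : T1 T2 / (wt (set_monomial T1) <= wt (set_monomial T2))%N.
  move=> wl s1 s2 e12; have [le12|/ltnW le21] := leqP (wt (set_monomial T1)) (wt (set_monomial T2)).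
    exact: wl.
  by apply/esym/wl.
rewrite !inE => /andP[T10 i1] /andP[T20 i2] /eqP.
rewrite eq_sym eqn_mod_dvd // => /dvdnP[c cE].
have wtE : wt (U_(ord0) *+ c + set_monomial T1) = wt (set_monomial T2).
  by rewrite wtD wtMn wtU; lia.
have /mnmP E : (U_(ord0) *+ c + set_monomial T1)%MM = set_monomial T2.
  exact: (irr_inj (irr_x0_powerM (a_gt0 := a_gt0) a_mono cm c i1) i2 wtE).
apply/setP => i; have := E i; rewrite mnmDE mulmnE mnm1E !mnmE.
have [<-|i0] := eqVneq ord0 i; first by rewrite (negPf T10) (negPf T20).
by rewrite mul0n; case: (i \in T1); case: (i \in T2).
Qed.

(** Reduction of the weight modulo [a ord0] is a bijection onto residues; a preimage is a normal
    form stripped of its power of x_1. *)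
Lemma card_standard_sets : #|standard_sets| = a ord0.
Proof.
pose r T := Ordinal (ltn_pmod (wt (set_monomial T)) (a_gt0 ord0)).
rewrite -[RHS](card_ord (a ord0)) -cardsT -(card_in_imset (f := r)); last first.
  by move=> T1 T2 s1 s2 [e12]; apply: standard_sets_inj.
congr (#|pred_of_set _|); apply/setP => t; rewrite inE.
have [m mt] := a_residue t.
have im : irr (nf m) by apply: irr_nf.
have [T T0 mE] := squarefreeE (irr_squarefree im).
apply/imsetP; exists T.
  by rewrite inE T0; apply: irr_sub (U_(ord0) *+ nf m ord0)%MM _; rewrite addmC -mE.
apply: val_inj => /=; rewrite -(modn_small (ltn_ord t)) -mt -(nf_wt a_gt0) mE.
by rewrite wtD wtMn wtU mulnC modnMDl.
Qed.

Lemma card_standard_sets_ge : (n0.+1 <= #|standard_sets|)%N.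
Proof.
(* The n sets are the empty one, for [ord0], and the other singletons; they stand for 1 and x_2,
   ..., x_n. *)
pose h i : {set 'I_n0.+1} := [set i] :\ ord0.
rewrite -[leqLHS]card_ord -(card_imset (f := h)) => [|i j /setP hij]; last first.
  have [i0|i0] := eqVneq i ord0.
    have := hij j; rewrite !inE eqxx i0 andbT.
    by have [->|j0] := eqVneq j ord0.
  by have := hij i; rewrite !inE eqxx i0 => /esym/eqP.
apply: subset_leq_card; apply/subsetP => _ /imsetP[i _ ->].
rewrite !inE eqxx /=; have [->|i0] := eqVneq i ord0.
  rewrite (_ : set_monomial _ = 0%MM) ?irr0 //.
  by apply/mnmP => j; rewrite mnmE mnm0E !inE andNb.
rewrite (_ : set_monomial _ = U_(i)%MM); first exact: irrU.
apply/mnmP => j; rewrite mnmE mnm1E !inE eq_sym.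
by case: (eqVneq i j) => [<-|]; rewrite ?andbF // eq_sym i0.
Qed.

Lemma standard_sets_sub : standard_sets \subset powerset [set~ ord0].
Proof.
apply/subsetP => T; rewrite !inE => /andP[T0 _].
by apply/subsetP => i iT; rewrite !inE; apply: contraNneq T0 => <-.
Qed.

Lemma card_setC_ord0 : #|[set~ ord0 : 'I_n0.+1]| = n0.
Proof. by rewrite cardsC1 card_ord. Qed.

Definition without_pair i j :=
  [set T : {set 'I_n0.+1} | (ord0 \notin T) && ~~ ((i \in T) && (j \in T))].

(** The excluded sets contain both [i] and [j], hence correspond to the subsets of the other n0 - 2
    indices. *)
Lemma card_without_pair i j : i != ord0 -> j != ord0 -> i != j ->
  #|without_pair i j| = (2 ^ n0 - 2 ^ (n0 - 2))%N.
Proof.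
move=> i0 j0 ij.
pose A := [set~ ord0] :\ i :\ j.
have cardA : #|A| = (n0 - 2)%N.
  have := card_setC_ord0; rewrite (cardsD1 i) !inE i0 (cardsD1 j) !inE j0 eq_sym ij /=.
  by rewrite -/A; lia.
pose h T := i |: (j |: T).
pose B := h @: powerset A.
have cardB : #|B| = (2 ^ (n0 - 2))%N.
  have notin T : T \subset A -> (i \in T = false) * (j \in T = false).
    by move/subsetP=> TA; split; apply: contraTF isT => /TA; rewrite !inE eqxx ?andbF.
  rewrite card_in_imset ?card_powerset ?cardA // => T1 T2.
  rewrite !inE => /notin T1A /notin T2A /setP h12; apply/setP => k.
  have := h12 k; rewrite !inE.
  have [->|_] := eqVneq k i; first by rewrite T1A T2A.
  by have [->|//] := eqVneq k j; rewrite T1A T2A.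
have BE T : (T \in B) = [&& ord0 \notin T, i \in T & j \in T].
  apply/imsetP/and3P => [[T' ]|[T0 iT jT]].
    rewrite inE => /subsetP T'A ->; rewrite !inE !eqxx orbT; split=> //.
    rewrite !negb_or eq_sym i0 eq_sym j0 /=; apply/negP => /T'A.
    by rewrite !inE eqxx !andbF.
  exists (T :\ i :\ j).
    rewrite inE; apply/subsetP => k; rewrite !inE => /and3P[-> -> kT] /=.
    by apply: contraNneq T0 => <-.
  apply/setP => k; rewrite !inE.
  have [->|_] := eqVneq k i; first by rewrite iT.
  by have [->|_] := eqVneq k j; rewrite ?jT.
rewrite (_ : without_pair i j = powerset [set~ ord0] :\: B); last first.
  apply/setP => T; rewrite inE [RHS]inE BE inE.
  rewrite (_ : (T \subset [set~ ord0]) = (ord0 \notin T)); last first.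
    by rewrite subsetC sub1set inE.
  by case: (ord0 \in T); rewrite /= ?andbF ?andbT.
rewrite cardsD card_powerset card_setC_ord0 (setIidPr _) ?cardB //.
apply/subsetP => T; rewrite BE inE => /and3P[T0 _ _].
by rewrite subsetC sub1set inE.
Qed.

Lemma standard_sets_without_pair i j : i != j ->
  ~~ irr (U_(i) + U_(j))%MM -> standard_sets \subset without_pair i j.
Proof.
move=> ij nij; apply/subsetP => T; rewrite !inE => /andP[-> iT] /=.
apply: contraNN nij => /andP[iT' jT]; apply: irr_lem iT.
apply/mnm_lepP => k; rewrite mnmDE !mnm1E mnmE.
have [<-|ik] := eqVneq i k; first by rewrite iT' eq_sym (negPf ij).
by case: eqP => [<-|//]; rewrite jT.
Qed.

(** * Confluent rewriting of squares when all products of distinct variables are irreducible *)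

Section Rewriting.
Hypothesis pairs_irr : forall i j,
  i != ord0 -> j != ord0 -> i != j -> irr (U_(i) + U_(j))%MM.

Lemma reducible_square u : mdeg u = 2%N -> ~~ irr u ->
  exists2 i, i != ord0 & u = (U_(i) + U_(i))%MM.
Proof.
move=> u2 niu; have [i [j uE]] := mdeg2P u2.
have [i0|i0] := eqVneq i ord0.
  by case/negP: niu; rewrite uE i0; apply: (irr_x0 a_mono cm); apply: irrU.
have [j0|j0] := eqVneq j ord0.
  by case/negP: niu; rewrite uE j0 addmC; apply: (irr_x0 a_mono cm); apply: irrU.
have [ij|ij] := eqVneq i j; first by exists i; rewrite // uE ij.
by case/negP: niu; rewrite uE; apply: pairs_irr.
Qed.

(** [None] records that x_i^2 is zero in the tangent cone. *)
Definition square_nf i :=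
  let s := nf (U_(i) + U_(i))%MM in if mdeg s == 2%N then Some s else None.

Lemma square_nfP i s : i != ord0 -> square_nf i = Some s ->
  ((U_(i) + U_(i))%MM < s)%O /\ wt s = wt (U_(i) + U_(i))%MM.
Proof.
move=> i0; rewrite /square_nf; case: ifP => // _ [<-]; split; last exact: nf_wt.
rewrite lt_neqAle nf_ge andbT eq_sym.
exact: (square_reducible a_gt0 a_mono quadratic i0).
Qed.

(** Termination measure: a replacement keeps the weight and moves up in the order, so fewer
    monomials of that weight remain above. *)
Definition rank u :=
  #|[set v : 'X_{1..n0.+1 < (wt u).+1} | (u < v)%O && (wt v == wt u)]|.

Lemma rank_lt u v : wt v = wt u -> (u < v)%O -> (rank v < rank u)%N.
Proof.
move=> vu uv; rewrite /rank vu; apply: proper_card.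
rewrite properE; apply/andP; split.
  by apply/subsetP => w; rewrite !inE => /andP[/(lt_trans uv)-> ->].
have vb : (mdeg v < (wt u).+1)%N by rewrite -vu ltnS mdeg_le_wt.
by apply/subsetPn; exists (BMultinom vb); rewrite !inE /= ?uv ?vu ?ltxx ?eqxx.
Qed.

Lemma rank_step i s w : i != ord0 -> square_nf i = Some s ->
  (rank (w + s)%MM < rank (w + (U_(i) + U_(i)))%MM)%N.
Proof.
move=> i0 /(square_nfP i0)[lt_s wt_s]; apply: rank_lt; first by rewrite wtD wt_s -wtD.
by rewrite ltmc_add2r.
Qed.

(* Replaces [x_i ^ 2] by its value in the associated graded ring until the
   monomial is squarefree outside [x_1]; [None] stands for zero, and [t] is
   fuel. *)
Fixpoint rewrite_squares (t : nat) u : option 'X_{1..n0.+1} :=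
  if t is t'.+1 then
    if [pick i | (i != ord0) && (1 < u i)%N] is Some i then
      if square_nf i is Some s then
        rewrite_squares t' (u - (U_(i) + U_(i)) + s)%MM
      else None
    else Some u
  else None.

Lemma rewrite_squares_stable t1 t2 u : (rank u < t1)%N -> (rank u < t2)%N ->
  rewrite_squares t1 u = rewrite_squares t2 u.
Proof.
elim: t1 t2 u => // t1 IHt [//|t2] u /=; rewrite !ltnS => u1 u2.
case: pickP => // i /andP[i0 ui]; case si: (square_nf i) => [s|//].
have lt_s := rank_step (u - (U_(i) + U_(i)))%MM i0 si.
rewrite submK ?lem_double // in lt_s.
by apply: IHt; apply: leq_trans lt_s _.
Qed.

Definition square_free_form u := rewrite_squares (rank u).+1 u.

Lemma square_free_formE u : square_free_form u =
  if [pick i | (i != ord0) && (1 < u i)%N] is Some i then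
    if square_nf i is Some s then
      square_free_form (u - (U_(i) + U_(i)) + s)%MM
    else None
  else Some u.
Proof.
rewrite {1}/square_free_form /=; case: pickP => // i /andP[i0 ui].
case si: (square_nf i) => [s|//]; apply: rewrite_squares_stable => //.
by have := rank_step (u - (U_(i) + U_(i)))%MM i0 si; rewrite submK ?lem_double.
Qed.

Lemma square_free_form_id u : squarefree u -> square_free_form u = Some u.
Proof.
move=> /forallP u1; rewrite square_free_formE; case: pickP => // i /andP[i0 ui].
by have := implyP (u1 i) i0; rewrite leqNgt ui.
Qed.

(* The rewriting is confluent because distinct squares are coprime. *)
Lemma square_free_form_step i w : i != ord0 ->
  square_free_form (w + (U_(i) + U_(i)))%MM =
  if square_nf i is Some s then square_free_form (w + s)%MM else None.
Proof.
move: {2}(rank _) (leqnn (rank (w + (U_(i) + U_(i)))%MM)) => t.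
elim/ltn_ind: t i w => t IHt i w ut i0.
have ui : (1 < (w + (U_(i) + U_(i)))%MM i)%N by rewrite !mnmDE mnm1E eqxx; lia.
rewrite square_free_formE; case: pickP => [j /andP[j0 uj]|/(_ i)]; last by rewrite i0 ui.
have [->|ij] := eqVneq j i; first by rewrite addmK.
(* Since j differs from i, x_j^2 already divides [w]. The two replacements commute, and the
   induction hypothesis applies after either of them. *)
have wj : (1 < w j)%N by move: uj; rewrite !mnmDE mnm1E eq_sym (negPf ij) !addn0.
have wE := submK (lem_double wj).
set w' := (w - (U_(j) + U_(j)))%MM in wE.
rewrite -wE in ut *.
have -> : (w' + (U_(j) + U_(j)) + (U_(i) + U_(i)) - (U_(j) + U_(j)) =
  w' + (U_(i) + U_(i)))%MM by rewrite -addmA [X in (_ + X)%MM]addmC addmA addmK.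
have swap x y : (w' + x + y = w' + y + x)%MM by rewrite -!addmA [(x + y)%MM]addmC.
case sj: (square_nf j) => [s|]; last first.
  case si: (square_nf i) => [s'|//]; rewrite swap.
  have lt_t := rank_step (w' + (U_(j) + U_(j)))%MM i0 si.
  by rewrite (IHt _ (leq_trans lt_t ut)) ?sj // swap.
have lt_t := rank_step (w' + (U_(i) + U_(i)))%MM j0 sj.
rewrite [X in (_ < rank X)%N]swap in lt_t.
rewrite swap (IHt _ (leq_trans lt_t ut)) //; last by rewrite swap.
case si: (square_nf i) => [s'|//].
have lt_t' := rank_step (w' + (U_(j) + U_(j)))%MM i0 si.
by rewrite swap [in RHS]swap (IHt _ (leq_trans lt_t' ut)) ?sj // swap.
Qed.

(** The functional [phi], selecting monomials that rewrite to [u], vanishes on the quadrics and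
    hence on the ideal. If [u] were reducible, its normal relation would have value 1. *)
Lemma squarefree_irr u : squarefree u -> irr u.
Proof.
move=> sqf_u; apply/negPn/negP => niu.
pose phi v := (square_free_form v == Some u)%:R : K.
have phi0 f : I f -> mlin phi f = 0.
  move=> /(quadratic_span a_gt0 quadratic).
  apply: mlin_gen_ideal => _ w [v [v2 niv ->]].
  have [i i0 vE] := reducible_square v2 niv.
  rewrite /normal_relation raddfB /= mlinX /phi [X in (X + w)%MM]vE addmC square_free_form_step //.
  rewrite /normal_tail /square_nf -vE v2.
  by case: ifP => _; [rewrite mlinX addmC subrr | rewrite mlin0 subr0].
have := phi0 _ (nf_rel_tangent a_gt0 K u).
rewrite /normal_relation raddfB /= mlinX /phi square_free_form_id // eqxx.
rewrite /normal_tail; case: ifP => _; last by rewrite mlin0 subr0 => /eqP; rewrite oner_eq0.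
rewrite mlinX square_free_form_id ?irr_squarefree ?irr_nf //.
by rewrite (inj_eq Some_inj) -/(irr u) (negPf niu) subr0 => /eqP; rewrite oner_eq0.
Qed.

Lemma card_standard_sets_full : #|standard_sets| = (2 ^ n0)%N.
Proof.
rewrite -[in RHS]card_setC_ord0 -card_powerset; congr (#|pred_of_set _|).
apply/eqP; rewrite eqEsubset standard_sets_sub; apply/subsetP => T.
rewrite !inE subsetC sub1set inE => -> /=.
exact/squarefree_irr/set_monomial_squarefree.
Qed.

End Rewriting.
End Counting.

(** * Leading monomials for the degree reverse lexicographic order *)

Lemma drl_ltP n (m m' : 'X_{1..n}) :
  drl_lt m m' <-> (mdeg m < mdeg m')%N \/ mdeg m = mdeg m' /\ (m' < m)%O.
Proof.
split=> [[|[md [i [eq_lt lt_i]]]]|[|[md lt_m]]]; try by left.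
  by right; split=> //; apply/ltmcP => //; exists i => // j /eq_lt.
have [i eq_lt lt_i] := ltmcP (esym md) lt_m.
by right; split=> //; exists i; split=> // j /eq_lt.
Qed.

(** Start from [mlead f], of top degree, and descend in the built-in order inside that degree, where
    it is opposite to [drl_lt]. *)
Lemma exists_lead_mon (K : fieldType) n (f : {mpoly K[n]}) :
  f != 0 -> exists m, lead_mon f m.
Proof.
move=> f0; have := mlead_supp f0; move: (erefl (mdeg (mlead f))).
elim/(@ltmwf n): {1 3}(mlead f) => m IHm md mf.
have [[v [vf vd vm]]|nov] :=
  classic (exists v, [/\ v \in msupp f, mdeg v = mdeg (mlead f) & (v < m)%O]).
  exact: IHm vm vd vf.
exists m; split=> // v vf vm; apply/drl_ltP.
have: (mdeg v <= mdeg m)%N by rewrite md -ltnS mlead_deg // msize_mdeg_lt.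
rewrite leq_eqVlt => /predU1P[vd|]; [right | by left].
split=> //; rewrite lt_neqAle eq_sym vm leNgt /=; apply/negP => lt_vm.
by apply: nov; exists v; rewrite vd.
Qed.

(** * Height, minimal generators and Gröbner basis in the case of equality *)

Section AlmostCompleteIntersection.
Variables (K : fieldType) (n0 : nat) (a : 'I_n0.+1 -> nat).
Hypothesis a_gt0 : forall i, (0 < a i)%N.
Hypothesis a_mono : forall i j : 'I_n0.+1, (i < j)%N -> (a i < a j)%N.
Hypothesis a_min : forall m i, weight a m = a i -> m = U_(i)%MM.
Local Notation S := {mpoly K[n0.+1]}.
Local Notation I := (@tangent_ideal K n0.+1 (toric_ideal a)).
Hypothesis cm : cohen_macaulay_quot I.
Hypothesis quadratic : exists Q : S -> Prop,
  (forall q, Q q -> homogeneous 2 q) /\ ideal_eq (gen_ideal Q) I.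
Local Notation wt := (weight a).
Local Notation nf := (normal_form a_gt0).
Local Notation irr := (irreducible a_gt0).
Local Notation nf_rel := (normal_relation a_gt0 K).
Implicit Types (f g : S) (m u v w : 'X_{1..n0.+1}) (k l : 'I_n0.+1).
Implicit Types (T : {set 'I_n0.+1}).

(** Other terms of the same weight and degree are [drl_lt]-smaller, hence larger in the built-in
    order, which an irreducible [m] forbids; the vanishing sum would be the leading coefficient
    alone. *)
Lemma lead_mon_reducible f m : I f -> lead_mon f m -> ~~ irr m.
Proof.
move=> If [mf mlead]; apply/negP => im.
have := tangent_gr_eq0 If im.
rewrite -big_filter (_ : [seq _ <- _ | _] = [seq v <- msupp f | pred1 m v]).
  rewrite filter_pred1_uniq ?msupp_uniq // big_seq1 => /eqP.
  by rewrite mcoeff_eq0 mf.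
apply: eq_in_filter => v vf /=; apply/andP/eqP => [[/eqP vm /eqP vd]|->]; last by rewrite !eqxx.
apply/eqP/negPn/negP => neq_vm; have /drl_ltP := mlead v vf neq_vm.
rewrite vd ltnn => -[//|[_]].
by rewrite ltNge (irr_max im).
Qed.

Lemma nf_rel_lead_mon u : ~~ irr u -> lead_mon (nf_rel u) u.
Proof.
move=> niu; split=> [|v vu neq_vu].
  by rewrite mcoeff_msupp nf_rel_coef_irr // eqxx oner_eq0.
apply/drl_ltP; right; split; first exact: nf_rel_homogeneous vu.
move: vu => /msuppB_le; rewrite mem_cat msuppX inE (negPf neq_vu) /=.
rewrite /normal_tail; case: ifP => _; last by rewrite msupp0.
by rewrite msuppX inE => /eqP->; rewrite lt_neqAle eq_sym nf_ge andbT.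
Qed.

Lemma nf_rel_neq0 u : ~~ irr u -> nf_rel u != 0.
Proof.
by move=> /nf_rel_lead_mon[+ _]; apply: contraTneq => ->; rewrite msupp0.
Qed.

Lemma tangent_prime_X P k : is_prime P -> (forall f, I f -> P f) ->
  k != ord0 -> P 'X_k.
Proof.
move=> [_ [P1 PM]] IP k0; have := IP _ (tangent_Xpower K a_mono k0).
rewrite -mpolyXn; elim: (a ord0) => [|t IHt]; first by rewrite expr0.
by rewrite exprS => /PM[].
Qed.

Lemma tangent_height : height_eq I n0.
Proof.
split.
  move=> P Pp IP; have PX k := tangent_prime_X (k := k) Pp IP.
  (* The chain is 0 < (x_2) < (x_2, x_3) < ..., with the given prime [P] in position n0. *)
  pose Z t k := (0 < k <= t)%N.
  pose c t := if (t < n0)%N then varideal (Z t) else P.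
  exists c; split; last by rewrite /c ltnn.
  split=> [t _|t tn]; first by rewrite /c; case: ifP => // _; apply: varideal_prime.
  have tn' : (t.+1 < n0.+1)%N by rewrite ltnS.
  have nZ : ~ varideal (Z t) ('X_(Ordinal tn') : S).
    by move=> /varidealX; rewrite /Z /= ltnn.
  rewrite /c tn; case: ltnP => tn1; split.
  - by move=> f; apply: varideal_mono => k /andP[k0 kt]; rewrite unfold_in /Z k0 ltnW.
  - by exists 'X_(Ordinal tn'); split=> //; apply/varidealX; rewrite /Z /= leqnn.
  - move=> f; apply: varideal_sub; first by case: Pp.
    by move=> k /andP[k0 _]; apply: PX; rewrite -lt0n.
  - by exists 'X_(Ordinal tn'); split=> //; apply: PX.
move=> /(_ _ (varideal_prime K (predC1 ord0)) (@tangent_varideal _ _ _ a_gt0 a_mono)).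
move=> [c [[cp cs] cP]].
(* A chain of length n0 + 1 below (x_2, ..., x_n) could be prolonged by (x_1, ..., x_n), exceeding
   the dimension n0 + 1. *)
pose c' t := if (t <= n0.+1)%N then c t else varideal predT.
suff /prime_chain_length : prime_chain c' n0.+2 by rewrite ltnn.
split=> [t _|t tn]; first by rewrite /c'; case: ifP => [/cp|_] //; apply: varideal_prime.
rewrite /c' -[X in if X then _ else varideal _]ltnS tn.
case: (ltnP t n0.+1) => tn1; first exact: cs.
have {tn tn1} -> : t = n0.+1 by lia.
split=> [f /cP|]; first exact: varideal_mono.
by exists 'X_ord0; split; [apply/varidealX | move=> /cP/varidealX].
Qed.

(** Elements of the ideal have no term of degree below 2, so only the constant term of [r] reaches
    degree 2. *)
Lemma mcoeffM_tangent r g u : I g -> mdeg u = 2%N ->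
  (r * g)@_u = r@_0%MM * g@_u.
Proof.
move=> Ig u2; rewrite {1}[r]mpolyE mulr_suml raddf_sum /=.
rewrite -(mlin_coeff 0%MM r) /mlin mulr_suml; apply: eq_bigr => w _.
rewrite -scalerAl mcoeffZ -mulrA; congr (_ * _).
have [->|w0] := eqVneq w 0%MM; first by rewrite mpolyX0 !mul1r.
rewrite mul0r -mlin_coeff mlinXM mlin_indicator big1 // => m /eqP mw.
apply: (tangent_coef_low quadratic) => //; rewrite -u2 -mw mdegD.
by rewrite -[ltnLHS]addn0 ltn_add2l lt0n mdeg_eq0.
Qed.

Variables i j : 'I_n0.+1.
Hypotheses (i0 : i != ord0) (j0 : j != ord0) (ij : i != j).
Hypothesis standardE : standard_sets a_gt0 = without_pair i j.

(** No square of x_1 is needed, so the index [ord0] is free to carry the extra monomial x_i x_j. *)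
Definition quadric_mon k : 'X_{1..n0.+1} :=
  if k == ord0 then (U_(i) + U_(j))%MM else (U_(k) + U_(k))%MM.

Lemma mdeg_quadric_mon k : mdeg (quadric_mon k) = 2%N.
Proof. by rewrite /quadric_mon; case: ifP; rewrite mdegD !mdeg1. Qed.

Lemma quadric_mon_reducible k : ~~ irr (quadric_mon k).
Proof.
rewrite /quadric_mon; case: ifPn => k0; last exact: (square_reducible a_gt0 a_mono quadratic k0).
have -> : (U_(i) + U_(j))%MM = set_monomial [set i; j].
  apply/mnmP => t; rewrite mnmDE !mnm1E mnmE !inE !(eq_sym t).
  by have [<-|//] := eqVneq i t; rewrite eq_sym (negPf ij).
have : ([set i; j] \in standard_sets a_gt0) = ([set i; j] \in without_pair i j).
  by rewrite standardE.
rewrite !inE !eqxx orbT andbF !(eq_sym ord0) negb_or i0 j0 /=.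
by move=> ->.
Qed.

(** Without a square of some x_k, k > 1, [m] is a power of x_1 times a reducible set monomial, and
    [standardE] puts both [i] and [j] in that set. *)
Lemma reducible_quadric_mon m : ~~ irr m -> exists k, (quadric_mon k <= m)%MM.
Proof.
move=> nim; have [sqf|] := boolP (squarefree m); last first.
  rewrite negb_forall => /existsP[k]; rewrite negb_imply -ltnNge => /andP[k0 mk].
  by exists k; rewrite /quadric_mon (negPf k0) lem_double.
have [T T0 mE] := squarefreeE sqf; exists ord0; rewrite /quadric_mon eqxx.
have : (T \in standard_sets a_gt0) = (T \in without_pair i j) by rewrite standardE.
rewrite !inE T0 /=.
have -> : irr (set_monomial T) = false.
  by apply: contraNF nim; rewrite mE => /(irr_x0_powerM a_mono cm); apply.
move/esym/negbFE/andP=> [iT jT]; apply/mnm_lepP => k.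
rewrite mE !mnmDE !mnm1E [set_monomial T k]mnmE.
have [<-|_] := eqVneq i k; first by rewrite iT eq_sym (negPf ij) leq_addl.
by have [<-|//] := eqVneq j k; rewrite jT leq_addl.
Qed.

Lemma quadric_mon_inj : injective quadric_mon.
Proof.
(* For l other than [ord0], x_l has exponent 2 in [quadric_mon l] but at most 1 in x_i x_j. *)
suff sym k l : quadric_mon k = quadric_mon l -> l != ord0 -> k = l.
  move=> k l kl; have [l0|l0] := eqVneq l ord0; last exact: sym.
  have [k0|k0] := eqVneq k ord0; first by rewrite k0 l0.
  by apply/esym/sym.
move=> /mnmP/(_ l) + l0; rewrite /quadric_mon (negPf l0).
case: ifP => k0; rewrite !mnmDE !mnm1E eqxx; last by case: eqP.
by have [<-|] := eqVneq i l; [rewrite eq_sym (negPf ij) | case: (j == l)].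
Qed.

Lemma reducible_degree2 m : mdeg m = 2%N -> ~~ irr m -> exists k, m = quadric_mon k.
Proof.
move=> m2 /reducible_quadric_mon[k km]; exists k; have := submK km.
have : mdeg (m - quadric_mon k)%MM == 0%N.
  by have := congr1 mdeg (submK km); rewrite mdegD m2 mdeg_quadric_mon; lia.
by rewrite mdeg_eq0 => /eqP->; rewrite add0m.
Qed.

Definition quadrics := [seq nf_rel (quadric_mon k) | k <- enum 'I_n0.+1].

Lemma quadrics_generate : generated_by I quadrics.
Proof.
move=> f; split.
  apply: gen_ideal_min; first exact: tangent_is_ideal.
  by move=> _ /mapP[k _ ->]; apply: nf_rel_tangent.
move=> /(quadratic_span a_gt0 quadratic); apply: gen_ideal_min; first exact: gen_ideal_is_ideal.
move=> _ [u [u2 /(reducible_degree2 u2)[k ->] ->]]; apply: gen_ideal_sub.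
by apply/mapP; exists k; rewrite ?mem_enum.
Qed.

Lemma tangent_mingens : mingens_eq I n0.+1.
Proof.
split.
  exists quadrics; split; last exact: quadrics_generate.
  by rewrite size_map -cardE card_ord.
move=> s sI; have sub_s g : g \in s -> I g by move=> gs; apply/sI/gen_ideal_sub.
(* Rows are the generators read off at the n quadric monomials. The normal relations give the unit
   vectors there, so [M] has rank n and at least n rows. *)
pose M : 'M[K]_(size s, n0.+1) := \matrix_(p, l) (s`_p)@_(quadric_mon l).
suff : (1%:M <= M)%MS.
  by move/mxrankS; rewrite mxrank1 => /leq_trans; apply; apply: rank_leq_row.
apply/row_subP => k.
have [t [ts kE]] : gen_ideal (fun g => g \in s) (nf_rel (quadric_mon k)).
  exact/sI/nf_rel_tangent.
have -> : row k 1%:M = \sum_(q <- t) q.1@_0%MM *: (\row_l q.2@_(quadric_mon l)).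
  apply/rowP => l; rewrite summxE !mxE.
  transitivity ((nf_rel (quadric_mon k))@_(quadric_mon l)).
    by rewrite nf_rel_coef_irr ?quadric_mon_reducible // (inj_eq quadric_mon_inj).
  rewrite kE raddf_sum big_seq [RHS]big_seq; apply: eq_bigr => q /ts /sub_s qI /=.
  by rewrite !mxE mcoeffM_tangent // mdeg_quadric_mon.
rewrite big_seq; apply: summx_sub => q /ts qs; apply: scalemx_sub.
have ps : (index q.2 s < size s)%N by rewrite index_mem.
rewrite (_ : \row__ _ = row (Ordinal ps) M) ?row_sub //.
by apply/rowP => l; rewrite !mxE /= nth_index.
Qed.

Lemma tangent_aci : almost_complete_intersection I.
Proof. by exists n0; split; [apply: tangent_height | apply: tangent_mingens]. Qed.

Lemma quadrics_groebner :
  (forall g, g \in quadrics -> homogeneous 2 g /\ g != 0) /\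
  groebner_basis I quadrics.
Proof.
split=> [_ /mapP[k _ ->]|].
  split; last exact/nf_rel_neq0/quadric_mon_reducible.
  by have := @nf_rel_homogeneous _ _ a_gt0 K (quadric_mon k); rewrite mdeg_quadric_mon.
split=> [_ /mapP[k _ ->]|f If f0]; first exact: nf_rel_tangent.
have [m fm] := exists_lead_mon f0.
have [k km] := reducible_quadric_mon (lead_mon_reducible If fm).
exists (nf_rel (quadric_mon k)); split; first by apply/mapP; exists k; rewrite ?mem_enum.
split; first exact/nf_rel_neq0/quadric_mon_reducible.
exists (quadric_mon k), m; split; first exact/nf_rel_lead_mon/quadric_mon_reducible.
by split=> //; apply/mnm_lepP.
Qed.

End AlmostCompleteIntersection.

(** * From the numerical semigroup to the hypotheses on weights *)

Section NumericalSemigroup.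
Variables (H : pred nat) (n0 : nat) (a : 'I_n0.+1 -> nat).
Hypothesis semigroup_H : num_semigroup H.
Hypothesis a_mono : forall i j : 'I_n0.+1, (i < j)%N -> (a i < a j)%N.
Hypothesis min_genE : forall x, min_gen H x <-> exists i, a i = x.
Local Notation wt := (weight a).
Implicit Types (m : 'X_{1..n0.+1}) (i j : 'I_n0.+1).

Lemma generator_min_gen i : min_gen H (a i).
Proof. by apply/min_genE; exists i. Qed.

Lemma generator_gt0 i : (0 < a i)%N.
Proof. by case: (generator_min_gen i) => _ []. Qed.

Lemma weight_semigroup m : H (wt m).
Proof.
have [H0 [HD _]] := semigroup_H.
apply: (big_ind H) => // i _; elim: (m i) => [|t IHt]; first by rewrite mul0n.
by rewrite mulSn; apply: HD => //; case: (generator_min_gen i).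
Qed.

(** Splitting off a variable of [m] writes [a i] as a sum of semigroup elements, so minimality
    forces the remaining monomial to be 1. *)
Lemma generator_weight m i : wt m = a i -> m = U_(i)%MM.
Proof.
have [_ [ai_gt0 ai_min]] := generator_min_gen i => mi.
have [j mj] : exists j, m j != 0%N.
  apply/existsP; apply: contraLR ai_gt0; rewrite negb_exists => /forallP m0.
  rewrite -mi /weight big1 // => j _.
  by move: (m0 j); rewrite negbK => /eqP->.
move: mi; rewrite -lep1mP in mj; rewrite -(submK mj) wtD wtU.
have [->|m'0] := eqVneq (m - U_(j))%MM 0%MM.
  by rewrite wt0 => /(a_inj a_mono)->; rewrite add0m.
move=> aiE; case: ai_min; exists (wt (m - U_(j))%MM), (a j); split.
  exact: weight_semigroup.
split; first by case: (generator_min_gen j).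
split; last by rewrite generator_gt0.
by rewrite (leq_trans _ (mdeg_le_wt generator_gt0 _)) // lt0n mdeg_eq0.
Qed.

Lemma semigroup_weight x : H x -> exists m, wt m = x.
Proof.
elim/ltn_ind: x => x IHx Hx; have [->|x0] := eqVneq x 0%N.
  by exists 0%MM; rewrite wt0.
have [[y [z [Hy [Hz [y0 [z0 xE]]]]]]|x_min] := classic (exists y z,
    H y /\ H z /\ (0 < y)%N /\ (0 < z)%N /\ x = (y + z)%N).
  have [m1 m1y] : exists m, wt m = y by apply: IHx => //; lia.
  have [m2 m2z] : exists m, wt m = z by apply: IHx => //; lia.
  by exists (m1 + m2)%MM; rewrite wtD m1y m2z.
have /min_genE[i ix] : min_gen H x by rewrite /min_gen lt0n.
by exists U_(i)%MM; rewrite wtU.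
Qed.

Lemma weight_residue r : exists m, wt m = r %[mod a ord0].
Proof.
have [_ [_ [N HN]]] := semigroup_H.
have [|m mE] := @semigroup_weight (r + N * a ord0)%N.
  by apply: HN; rewrite (leq_trans _ (leq_addl _ _)) // leq_pmulr ?generator_gt0.
by exists m; rewrite mE addnC modnMDl.
Qed.

Lemma emb_mult_ord0 e : is_emb_mult H e -> e = a ord0.
Proof.
move=> [/min_genE[i <-] e_min]; apply/eqP.
by rewrite eqn_leq e_min ?a0_le //; apply: generator_min_gen.
Qed.

End NumericalSemigroup.

Theorem theorem1p9 (K : fieldType) (H : pred nat) (n : nat) (a : 'I_n -> nat)
  (e : nat) :
  num_semigroup H ->
  (forall i j : 'I_n, (i < j)%N -> (a i < a j)%N) ->
  (forall x, min_gen H x <-> exists i, a i = x) ->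
  is_emb_mult H e ->
  (* H is quadratic *)
  (exists Q : {mpoly K[n]} -> Prop,
      (forall q, Q q -> homogeneous 2 q) /\
      ideal_eq (gen_ideal Q) (tangent_ideal (@toric_ideal K n a))) ->
  (* gr_m K[H] = S / I_H^* is Cohen-Macaulay *)
  cohen_macaulay_quot (tangent_ideal (@toric_ideal K n a)) ->
  ((n <= e <= 2 ^ n.-1 - 2 ^ (n - 3))%N \/ e = (2 ^ n.-1)%N) /\
  (e = (2 ^ n.-1 - 2 ^ (n - 3))%N ->
     almost_complete_intersection (tangent_ideal (@toric_ideal K n a)) /\
     exists G : seq {mpoly K[n]},
       (forall g, g \in G -> homogeneous 2 g /\ g != 0) /\
       groebner_basis (tangent_ideal (@toric_ideal K n a)) G).
Proof.
move=> sgH a_mono genE; case: n a a_mono genE => [|n0] a a_mono genE eH quadratic cm.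
  (* For n = 0 there is no minimal generator, hence no multiplicity. *)
  by case: eH => /genE[[]].
have eE := emb_mult_ord0 a_mono genE eH.
have a_gt0 := generator_gt0 genE.
have a_min := generator_weight sgH a_mono genE.
have a_res := weight_residue sgH genE.
have cardE : #|standard_sets a_gt0| = e.
  by rewrite eE (card_standard_sets a_gt0 a_mono a_res cm quadratic).
rewrite subSS /=.
(* The dichotomy is whether some x_i x_j with distinct i, j other than [ord0] is reducible. *)
have [/existsP[i /existsP[j /and4P[i0 j0 ij nij]]]|no_pair] :=
  boolP [exists i, exists j, [&& i != ord0, j != ord0, i != j
    & ~~ irreducible a_gt0 (U_(i) + U_(j))%MM]].
  have sub := standard_sets_without_pair ij nij.
  have e_ge : (n0.+1 <= e)%N by rewrite -cardE card_standard_sets_ge.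
  rewrite -(card_without_pair i0 j0 ij) e_ge -cardE subset_leq_card //.
  split; [by left | move=> card_eq].
  have standardE : standard_sets a_gt0 = without_pair i j.
    by apply/eqP; rewrite eqEcard sub card_eq /=.
  split; first exact: (tangent_aci a_mono cm quadratic i0 j0 ij standardE).
  exists (quadrics K a_gt0 i j).
  exact: (quadrics_groebner a_mono cm quadratic i0 j0 ij standardE).
have e_full : e = (2 ^ n0)%N.
  rewrite -cardE; apply: (card_standard_sets_full a_mono a_min cm quadratic).
  move=> i j i0 j0 ij; apply: contraNT no_pair => nij.
  by apply/existsP; exists i; apply/existsP; exists j; rewrite i0 j0 ij.
split; first by right.
(* Here (b) is vacuous: 2^n0 differs from 2^n0 - 2^(n0-2), because both powers are positive. *)
have := expn_gt0 2 n0; have := expn_gt0 2 (n0 - 2); rewrite e_full; lia.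
Qed.
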